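(* Let $\mathbb{F}(n)=\mathbb{F}(n;1,\dots,1)=SU(n)/S(U(1)\times\cdots\times U(1))$ be the full flag manifold and let $X\in\mathfrak{m}\cong T_o\mathbb{F}(n)$ be represented by the skew-Hermitian matrix $A\in M_n(\mathbb{C})$ with zero diagonal. Then: (i) $X$ is an equigeodesic vector in $\mathbb{F}(n)$ if and only if $A$ is essentially diagonal, i.e. $A$ contains at most one non-zero entry in each row and in each column. (ii) If $X$ is an equigeodesic vector and the entries of $A$ are commensurate, then the corresponding equigeodesic $\gamma(t)=(\exp tX)\cdot o$ is closed.
   Context: Let $G=SU(n)$, $K=S(U(1)\times\cdots\times U(1))$ (diagonal matrices in $SU(n)$), with Lie algebras $\mathfrak{g}=\mathfrak{su}(n)$ and $\mathfrak{k}$, and let $o=eK$. Let $\langle\cdot,\cdot\rangle$ be the Cartan-Killing form of $\mathfrak{g}$ and $\mathfrak{m}=\mathfrak{k}^{\perp}$; $\mathfrak{m}$ consists of the skew-Hermitian $n\times n$ matrices $A=(a_{ij})$ with zero diagonal, and is identified with $T_o\mathbb{F}(n)$. An invariant metric on $\mathbb{F}(n)$ is a $G$-invariant Riemannian metric $g$; it is determined by an operator $\Lambda:\mathfrak{m}\to\mathfrak{m}$ via $g_o(X,Y)=-\langle\Lambda X,Y\rangle$, and the operators arising are those of the form $(\Lambda A)_{ij}=\lambda_{ij}a_{ij}$ for $i\ne j$, where $\lambda_{ij}=\lambda_{ji}>0$ are arbitrary positive reals. A vector $X$ is called an equigeodesic vector if the curve $\gamma(t)=(\exp tX)\cdot o$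 is a geodesic with respect to every invariant metric (constant curves are counted as geodesics). Complex numbers are commensurate if they are pairwise linearly dependent over $\mathbb{Q}$. A curve $\gamma:\mathbb{R}\to\mathbb{F}(n)$ is closed if there is $T>0$ with $\gamma(t+T)=\gamma(t)$ for all $t$. *)

(* Defs.v *)
From mathcomp Require Import all_boot all_order all_algebra.
From mathcomp Require Import complex.
From mathcomp Require Import all_classical all_reals all_analysis.

Set Implicit Arguments.
Unset Strict Implicit.
Unset Printing Implicit Defensive.

Import Order.TTheory GRing.Theory Num.Theory.
Import numFieldNormedType.Exports.

Local Open Scope classical_set_scope.
Local Open Scope ring_scope.
Local Open Scope complex_scope.
Local Open Scope sesquilinear_scope.

(** * Real calculus in coordinates *)

Section Calculus.
Variables (R : realType) (d : nat).
Implicit Types (U : set 'rV[R]_d) (f : 'rV[R]_d -> R).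

Definition partial (i : 'I_d) f (x : 'rV[R]_d) : R :=
  'D_(delta_mx 0 i : 'rV[R]_d) f x.

Fixpoint Ck_on (k : nat) U f : Prop :=
  if k is k'.+1 then
    (forall x, U x -> forall i, derivable f x (delta_mx 0 i : 'rV[R]_d)) /\
    (forall i, Ck_on k' U (partial i f))
  else forall x, U x -> {for x, continuous f}.

Definition smooth_on U f : Prop := forall k, Ck_on k U f.

Definition smooth_path_on (J : set R) (u : R -> R) : Prop :=
  forall k t, J t -> derivable (derive1n k u) t 1.

(** Christoffel symbol Γ^k_ij at [x] of the Riemannian metric with matrix
    [g] in the coordinates of R^d. *)
Definition christoffel (g : 'rV[R]_d -> 'M[R]_d) (x : 'rV[R]_d)
    (k i j : 'I_d) : R :=
  2^-1 * \sum_(l < d) invmx (g x) k l *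
    (partial i (fun z => g z j l) x + partial j (fun z => g z i l) x
     - partial l (fun z => g z i j) x).

(** The equation ∇_{y'} y' = 0 for the Levi-Civita connection of [g]. *)
Definition geodesic_equation (g : 'rV[R]_d -> 'M[R]_d) (y : R -> 'rV[R]_d)
    (t : R) : Prop :=
  forall k : 'I_d,
    derive1n 2 (fun s => y s 0 k) t
    + \sum_(i < d) \sum_(j < d) christoffel g (y t) k i j *
        derive1 (fun s => y s 0 i) t * derive1 (fun s => y s 0 j) t = 0.

End Calculus.

(** * The flag manifold F(n) = SU(n) / S(U(1) x ... x U(1)) *)

Section FlagManifold.
Variables (R : realType) (n : nat).
Local Notation C := R[i].
Local Notation M := 'M[C]_n.

Definition SU : set M := [set g | g \is unitarymx /\ \det g = 1].

Definition torus : set M := [set k | SU k /\ is_diag_mx k].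

(** The point gK of F(n). *)
Definition coset (g : M) : set M := [set g *m k | k in torus].

Definition skewhermitian (A : M) : Prop := A ^t* = - A.

Definition m_space : set M :=
  [set A | skewhermitian A /\ forall i, A i i = 0].

(** Projection of su(n) = k + m onto m. *)
Definition m_proj (Z : M) : M :=
  \matrix_(i, j) (if i == j then 0 else Z i j).

Definition ad (X Z : M) : M := X *m Z - Z *m X.

(** The trace of ad X o ad Y is taken over the complex space gl(n), which is
    the direct sum of the complexification of su(n) and of the centre, where
    ad X o ad Y vanishes. *)
Definition killing (X Y : M) : R :=
  complex.Re (\tr (lin_mx (ad X) *m lin_mx (ad Y))).

(** The operator Λ on m; its diagonal coefficients are irrelevant. *)
Definition metric_op (lam : 'I_n -> 'I_n -> R) (A : M) : M :=
  \matrix_(i, j) ((lam i j)%:C * A i j).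

Definition metric_coefs (lam : 'I_n -> 'I_n -> R) : Prop :=
  (forall i j, lam i j = lam j i) /\ (forall i j, i != j -> 0 < lam i j).

(** A tangent vector of F(n) at gK is the image of some V = gZ tangent to
    SU(n) at g, with Z in su(n), and its translate by g^-1 to T_o F(n) = m is
    the m-component of Z. *)
Definition to_origin (g V : M) : M := m_proj (g ^t* *m V).

(** The invariant metric with operator Λ, at gK. *)
Definition inv_metric (lam : 'I_n -> 'I_n -> R) (g V W : M) : R :=
  - killing (metric_op lam (to_origin g V)) (to_origin g W).

Definition flag_dim : nat := n * n.-1.
Local Notation E := 'rV[R]_flag_dim.

Definition smooth_mx_on (U : set E) (s : E -> M) : Prop :=
  forall i j, smooth_on U (fun x => complex.Re (s x i j)) /\
              smooth_on U (fun x => complex.Im (s x i j)).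

Definition partial_mx (l : 'I_flag_dim) (s : E -> M) (x : E) : M :=
  \matrix_(i, j) (partial l (fun z => complex.Re (s z i j)) x
                  +i* partial l (fun z => complex.Im (s z i j)) x).

(** Local coordinates x |-> s(x)K on F(n), given through a smooth lift to
    SU(n); such a lift exists locally since SU(n) -> F(n) is a principal
    bundle. The last clause says that the differential of x |-> s(x)K is
    injective; the dimensions being equal, x |-> s(x)K is then a local
    diffeomorphism, and a chart after shrinking U. *)
Definition local_coordinates (U : set E) (s : E -> M) : Prop :=
  [/\ open U,
      (forall x, U x -> SU (s x)),
      smooth_mx_on U s &
      forall x, U x -> forall v : E,
        to_origin (s x)
          (\sum_(l < flag_dim) (v 0 l)%:C *: partial_mx l s x) = 0 ->
        v = 0].

Definition metric_matrix (lam : 'I_n -> 'I_n -> R) (s : E -> M) (x : E) :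
    'M[R]_flag_dim :=
  \matrix_(i, j) inv_metric lam (s x) (partial_mx i s x) (partial_mx j s x).

(** A curve in F(n) is smooth when it has a smooth lift to SU(n). *)
Definition smooth_curve (c : R -> set M) : Prop :=
  exists g : R -> M,
    [/\ forall t, SU (g t),
        forall t, c t = coset (g t) &
        forall i j, smooth_path_on setT (fun t => complex.Re (g t i j)) /\
                    smooth_path_on setT (fun t => complex.Im (g t i j))].

(** Geodesics: smooth curves satisfying the geodesic equation in all local
    coordinates. *)
Definition geodesic (lam : 'I_n -> 'I_n -> R) (c : R -> set M) : Prop :=
  smooth_curve c /\
  forall (U : set E) (s : E -> M) (J : set R) (y : R -> E),
    local_coordinates U s -> open J ->
    (forall l, smooth_path_on J (fun t => y t 0 l)) ->
    (forall t, J t -> U (y t) /\ c t = coset (s (y t))) ->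
    forall t, J t -> geodesic_equation (metric_matrix lam s) y t.

Definition expmx (A : M) : M :=
  let S (N : nat) : M := \sum_(k < N) (k`!%:R)^-1 *: A ^+ k in
  \matrix_(i, j) (limn (fun N => complex.Re (S N i j))
                  +i* limn (fun N => complex.Im (S N i j))).

(** t |-> (exp tX).o *)
Definition orbit_curve (X : M) (t : R) : set M := coset (expmx (t%:C *: X)).

Definition equigeodesic_vector (X : M) : Prop :=
  forall lam, metric_coefs lam -> geodesic lam (orbit_curve X).

Definition closed_curve (c : R -> set M) : Prop :=
  exists2 T : R, 0 < T & forall t, c (t + T) = c t.

Definition essentially_diagonal (A : M) : Prop :=
  (forall i j k, A i j != 0 -> A i k != 0 -> j = k) /\
  (forall i j k, A i k != 0 -> A j k != 0 -> i = j).

Definition Q_dependent (z w : C) : Prop :=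
  exists p q : rat, (p, q) <> (0, 0) /\ ratr p * z + ratr q * w = 0.

Definition commensurate_entries (A : M) : Prop :=
  forall i j k l, Q_dependent (A i j) (A k l).

End FlagManifold.

(* Main.v *)
From HB Require Import structures.
Require Import Defs.
From mathcomp Require Import all_boot all_order all_algebra.
From mathcomp Require Import complex.
From mathcomp Require Import all_classical all_reals all_analysis.
From mathcomp Require Import ring lra.

(** Write Lambda for the operator of an invariant metric and L for its coefficients, put equal
    to zero on the diagonal. Everything rests on one computation: in any local coordinates, the
    geodesic equation for the orbit curve of X says that [Lambda X, X] is orthogonal to certain
    vectors, which span m when the coordinates are well chosen.

    Let s be a lift of local coordinates to SU(n), theta = s^-1 ds the pulled back Maurer-Cartan
    form, and Omega = theta(y') its value on the velocity of the coordinate path y. The metric is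
    g_ij = B(theta_i, theta_j), where B ([bform]) is minus the Killing form twisted by Lambda. After
    lowering the free index, the equations d theta = - theta /\ theta turn the Christoffel symbols
    into a bracket, and the geodesic equation becomes
      B(theta_l, Omega') = B(Omega, [Omega, theta_l])   for all l
    ([lowered_geodesic]). If y represents the orbit curve, then s(y(t)) = exp(tX) k(t) with k(t)
    in the torus, so Omega = Y + h with Y = k^-1 X k and h diagonal, and Omega' agrees with [Y, h]
    off the diagonal. As B is invariant under the torus, the terms with h cancel, and what is left is
    B(Y, [Y, theta_l]) = 0 for all l ([geodesic_equationP]). Up to a constant factor the left side is
    the real part of the trace of [Lambda Y, Y] theta_l ([bform_metric_bracket]), and
    [Lambda Y, Y] is conjugate to [Lambda X, X] by k.

    If X is essentially diagonal, [Lambda X, X] = 0 for all Lambda, because its entries are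
    the sums of (L_im - L_mj) X_im X_mj over m, and every term with i <> j is zero. Conversely, a
    chart around the base point in which the orbit curve is a straight line and whose theta_l
    form a basis of m at the base point gives [Lambda X, X] = 0 for all Lambda
    ([geodesic_bracket], [metric_bracket_eq0]); raising a single coefficient of the metric then
    isolates the product X_ik X_kj, which must vanish for distinct i, j, k.

    Two pieces of analysis support this. The chain rule and the symmetry of second
    derivatives are deduced from the mean value theorem. The exponential of a skew-Hermitian
    matrix is computed by diagonalizing it in a unitary basis ([expmx_skewP]): it is conjugate to
    the diagonal matrix of the cos(t a_j) + i sin(t a_j), where the i a_j are the eigenvalues. So
    the entries of the adapted chart are polynomials in sines and cosines of linear forms,
    which are plainly smooth.

    The spectral form also settles the closed case. If X is essentially diagonal, X^2 is
    diagonal with entries 0 or - |X_am|^2, so each a_j is, up to sign, zero or the modulus of an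
    entry. Commensurate entries make all the a_j rational multiples of one real number, and
    they then have a common period ([closed_orbit]). *)

Set Implicit Arguments.
Unset Strict Implicit.
Unset Printing Implicit Defensive.

Import Order.TTheory GRing.Theory Num.Theory.
Import numFieldNormedType.Exports.

Local Open Scope classical_set_scope.
Local Open Scope ring_scope.

Local Open Scope sesquilinear_scope.

(** * Chain rule and symmetry of second derivatives *)

Section RealCalculus.
Variables (R : realType) (d : nat).
Implicit Types (U : set 'rV[R]_d) (f : 'rV[R]_d -> R).
Local Notation e i := (delta_mx 0 i : 'rV[R]_d).

Lemma is_derive_line (V : normedModType R) (f : V -> R) (x v : V) (c : R) :
  derivable f (x + c *: v) v ->
  is_derive c 1 (fun h : R => f (x + h *: v)) ('D_v f (x + c *: v)).
Proof.
move=> df.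
have E : (fun h : R => h^-1 *: (((fun h : R => f (x + h *: v)) \o shift c) (h *: (1 : R))
           - f (x + c *: v)))
       = (fun h : R => h^-1 *: ((f \o shift (x + c *: v)) (h *: v) - f (x + c *: v))).
  apply/funext => h /=; congr (_ *: (f _ - _)).
  by rewrite scalerDl [_%:A]mulr1 addrCA addrA.
by apply: DeriveDef; rewrite /derivable /derive E.
Qed.

(** The parameter runs over [0, 1], so that the sign of [r] does not matter. *)
Lemma MVT_line (V : normedModType R) (f : V -> R) (x v : V) (r : R) :
  (forall c : R, 0 <= c <= 1 -> derivable f (x + (c * r) *: v) v) ->
  exists2 c : R, 0 <= c <= 1 &
    f (x + r *: v) - f x = r * 'D_v f (x + (c * r) *: v).
Proof.
move=> df.
pose g := fun c : R => f (x + (c * r) *: v).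
have dg (c : R) : 0 <= c <= 1 -> is_derive c 1 g (r * 'D_v f (x + (c * r) *: v)).
  move=> /df /is_derive_line dfc.
  rewrite mulrC.
  have dm : is_derive c 1 (fun c : R => c * r) r.
    have -> : (fun c : R => c * r) = r \*: id by apply/funext => z /=; rewrite mulrC.
    by apply: is_derive_eq; rewrite [_ *: _]mulr1.
  exact: (@is_derive1_comp _ (fun h : R => f (x + h *: v)) (fun c : R => c * r) _ _ _ dfc dm).
have gc : {within `[0, 1], continuous g}.
  by apply: derivable_within_continuous => c; rewrite in_itv /= => /dg [].
have dgo (c : R) : c \in `]0, 1[ -> is_derive c 1 g (r * 'D_v f (x + (c * r) *: v)).
  by rewrite in_itv /= => /andP[c0 c1]; apply: dg; rewrite !ltW.
have [c c01 E] := MVT_segment ler01 dgo gc.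
exists c; first by move: c01; rewrite in_itv.
by move: E; rewrite /g mul1r mul0r scale0r addr0 subr0 mulr1.
Qed.

Lemma delta_normE (i : 'I_d) (r : R) : `|r *: e i| = `|r|.
Proof.
rewrite normrZ -[RHS]mulr1; congr (_ * _).
rewrite [LHS]/Num.Def.normr /= mx_normrE.
apply/eqP; rewrite eq_le; apply/andP; split.
  apply: bigmax_le => // -[a b] _ /=; rewrite mxE.
  by case: (_ && _); rewrite ?normr1 ?normr0.
apply: le_trans (le_bigmax _ _ (0, i)).
by rewrite mxE !eqxx normr1.
Qed.

Lemma norm_rowP (v w : 'rV[R]_d) : (forall i, `|v 0 i| <= `|w 0 i|) -> `|v| <= `|w|.
Proof.
move=> vw; rewrite [leLHS]/Num.Def.normr [leRHS]/Num.Def.normr /= !mx_normrE.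
apply: bigmax_le => [|[a b] _ /=]; first exact: bigmax_ge_id.
rewrite (ord1 a); apply: le_trans (vw b) _.
exact: (le_bigmax _ (fun i : 'I_1 * 'I_d => `|w i.1 i.2|) (0, b)).
Qed.

(** Going from [x] to [x + v] one coordinate at a time and applying the mean value theorem to each
    step, the increment is a sum of v_i times partial derivatives taken near [x]. *)
Lemma C1_approx U f x : open U -> U x -> Ck_on 1 U f ->
  forall eps : R, 0 < eps -> exists2 del : R, 0 < del &
   forall v : 'rV[R]_d, `|v| < del ->
   `|f (x + v) - f x - \sum_(i < d) v 0 i * partial i f x|
     <= eps * \sum_(i < d) `|v 0 i|.
Proof.
move=> oU Ux [df cf] eps eps0.
have : \forall z \near x, U z /\ forall i, `|partial i f x - partial i f z| <= eps.
  have H : \forall z \near x, forall i : 'I_d, `|partial i f x - partial i f z| <= eps.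
    have Hi (i : 'I_d) : \forall z \near x, `|partial i f x - partial i f z| <= eps.
      by move/cvgrPdist_le: (cf i x Ux); exact.
    exact: (@filter_forall _ _ _ _ _ Hi).
  have H' := open_nbhs_nbhs (conj oU Ux).
  by near=> z; split; [near: z; exact: H'|near: z; exact: H].
move=> /nbhs_ballP [del /= del0 Hdel]; exists del => // v vdel.
(* the first k coordinates of v *)
pose P k : 'rV[R]_d := \row_i (if (i < k)%N then v 0 i else 0).
have PS (k : 'I_d) : P k.+1 = P k + v 0 k *: e k.
  apply/rowP => j; rewrite !mxE eqxx /= ltnS leq_eqVlt.
  have [->|jk] := eqVneq j k; first by rewrite eqxx ltnn /= mulr1 add0r.
  by rewrite (_ : (j : nat) == k = false) ?mulr0 ?addr0 //; exact/negbTE.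
have tel : f (x + v) - f x = \sum_(i < d) (f (x + P i.+1) - f (x + P i)).
  rewrite -(big_mkord xpredT (fun i => f (x + P i.+1) - f (x + P i))) telescope_sumr //.
  congr (f _ - f _); first by congr (_ + _); apply/rowP => j; rewrite mxE ltn_ord.
  by rewrite (_ : P 0%N = 0) ?addr0 //; apply/rowP => j; rewrite !mxE.
have Pin (k : 'I_d) (c : R) : 0 <= c <= 1 -> ball x del (x + P k + (c * v 0 k) *: e k).
  move=> /andP[c0 c1]; rewrite -ball_normE /= -addrA opprD addNKr normrN.
  apply: le_lt_trans vdel; apply: norm_rowP => i; rewrite !mxE eqxx /=.
  have [->|jk] := eqVneq i k.
    by rewrite ltnn add0r mulr1 normrM ler_piMl // ger0_norm.
  by rewrite mulr0 addr0; case: ifP => // _; rewrite normr0.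
rewrite tel -sumrB mulr_sumr; apply: le_trans (ler_norm_sum _ _ _) _.
apply: ler_sum => k _; rewrite PS addrA.
have [|c c01 ->] := @MVT_line _ f (x + P k) (e k) (v 0 k).
  by move=> c c01; apply: df; exact: (Hdel _ (Pin k c c01)).1.
rewrite -mulrBr normrM mulrC distrC ler_wpM2r //.
exact: (Hdel _ (Pin k c c01)).2.
Unshelve. all: by end_near. Qed.

Lemma cvg_sumr (T : Type) (F : set_system T) (FF : Filter F) (I : Type)
    (r : seq I) (P : pred I) (u : I -> T -> R) (l : I -> R) :
  (forall i, P i -> u i x @[x --> F] --> l i) ->
  \sum_(i <- r | P i) u i x @[x --> F] --> \sum_(i <- r | P i) l i.
Proof. by move=> H; apply: cvg_big => //; exact: add_continuous. Qed.

(** The error in [C1_approx] is small relative to the increment of [y], and the difference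
    quotient of [y] stays bounded by [M + 1]. *)
Lemma C1_chain U f (y : R -> 'rV[R]_d) t : open U -> U (y t) -> Ck_on 1 U f ->
  (forall i, derivable (fun s => y s 0 i) t 1) ->
  is_derive t 1 (fun s => f (y s))
    (\sum_(i < d) partial i f (y t) * derive1 (fun s => y s 0 i) t).
Proof.
move=> oU Uy Cf dy.
have dyt : derivable y t 1.
  by apply/derivable_mxP => i j; rewrite (ord1 i); exact: dy.
pose D (h : R) : 'rV[R]_d := y (h + t) - y t.
pose q (h : R) := h^-1 *: (f (y (h + t)) - f (y t)).
have s1 (h : R) : h *: (1 : R) = h by rewrite [_ *: _]mulr1.
pose L := \sum_(i < d) partial i f (y t) * derive1 (fun s => y s 0 i) t.
pose M := \sum_(i < d) `|derive1 (fun s => y s 0 i) t|.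
have M0 : 0 <= M by apply: sumr_ge0.
have cvDi (i : 'I_d) : h^-1 *: D h 0 i @[h --> 0^'] --> derive1 (fun s => y s 0 i) t.
  rewrite derive1E; move: (dy i); rewrite /derivable => H.
  have -> : (fun h : R => h^-1 *: D h 0 i) =
      (fun h : R => h^-1 *: (((fun s => y s 0 i) \o shift t) (h *: (1 : R)) - y t 0 i)).
    by apply/funext => h; rewrite !mxE /= s1.
  exact: H.
have cL : \sum_(i < d) partial i f (y t) * (h^-1 *: D h 0 i) @[h --> 0^'] --> L.
  apply: cvg_sumr => i _; apply: cvgM; [exact: cvg_cst|exact: cvDi].
have cM : \sum_(i < d) `|h^-1 *: D h 0 i| @[h --> 0^'] --> M.
  by apply: cvg_sumr => i _; apply: cvg_norm; exact: cvDi.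
have cD : D h @[h --> 0^'] --> (0 : 'rV[R]_d).
  have cy : {for t, continuous y} by apply/differentiable_continuous/derivable1_diffP.
  rewrite -(subrr (y t)); apply: cvgB; last exact: cvg_cst.
  apply: cvg_comp; last exact: cy.
  have : h + t @[h --> 0^'] --> 0 + t.
    by apply: cvgD; [exact: nbhs_dnbhs|exact: cvg_cst].
  by rewrite add0r.
have key : q h @[h --> 0^'] --> L.
  apply/cvgrPdist_le => eps eps0.
  have eta0 : 0 < eps / 2 / (M + 1) by rewrite divr_gt0 ?divr_gt0 ?ltr_wpDl.
  have [del del0 Hdel] := C1_approx oU Uy Cf eta0.
  have nD : \forall h \near 0^', `|D h| < del.
    by move/cvgr0Pnorm_lt: cD; exact.
  have nM : \forall h \near 0^', \sum_(i < d) `|h^-1 *: D h 0 i| < M + 1.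
    by apply: (cvgr_lt _ cM); rewrite ltrDl.
  have nL : \forall h \near 0^', `|L - \sum_(i < d) partial i f (y t) * (h^-1 *: D h 0 i)| <= eps / 2.
    by move/cvgrPdist_le: cL; apply; rewrite divr_gt0.
  pose S h := \sum_(i < d) partial i f (y t) * (h^-1 *: D h 0 i).
  near=> h.
  rewrite -(subrKA (S h)) (le_trans (ler_normD _ _)) // (splitr eps) lerD //.
    by near: h; exact: nL.
  have -> : S h - q h = - (h^-1 * (f (y t + D h) - f (y t) - \sum_(i < d) D h 0 i * partial i f (y t))).
    rewrite [in RHS]mulrBr opprB; congr (_ - _).
      by rewrite /S mulr_sumr; apply: eq_bigr => i _; rewrite mulrC -mulrA.
    by rewrite /q /D [y t + _]addrC subrK.
  rewrite normrN normrM.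
  have h2 : `|D h| < del by near: h; exact: nD.
  apply: le_trans (ler_wpM2l (normr_ge0 _) (Hdel _ h2)) _.
  rewrite mulrCA mulr_sumr.
  have -> : \sum_(i < d) `|h^-1| * `|D h 0 i| = \sum_(i < d) `|h^-1 *: D h 0 i|.
    by apply: eq_bigr => i _; rewrite normrM.
  have h3 : \sum_(i < d) `|h^-1 *: D h 0 i| < M + 1 by near: h; exact: nM.
  rewrite -[leRHS](divfK (_ : M + 1 != 0)); last by rewrite gt_eqF // ltr_wpDl.
  by rewrite ler_wpM2l // ltW.
have E : (fun h : R => h^-1 *: (((fun s => f (y s)) \o shift t) (h *: (1 : R)) - f (y t))) = q.
  by apply/funext => h /=; rewrite s1.
apply: DeriveDef; rewrite /derivable /derive E; first by apply/cvg_ex; exists L.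
exact: cvg_lim key.
Unshelve. all: by end_near. Qed.

Lemma is_derive_translate (V : normedModType R) (f : V -> R) (x v w : V) :
  derivable f (x + w) v -> is_derive x v (fun z => f (z + w)) ('D_v f (x + w)).
Proof.
move=> df.
have E : (fun h : R => h^-1 *: (((fun z => f (z + w)) \o shift x) (h *: v) - f (x + w)))
       = (fun h : R => h^-1 *: ((f \o shift (x + w)) (h *: v) - f (x + w))).
  by apply/funext => h /=; rewrite addrA.
by apply: DeriveDef; rewrite /derivable /derive E.
Qed.

(** The mean value theorem in direction [i] for the increment in direction [j], then in direction
    [j] for the partial derivative along [i]. *)
Lemma second_difference U f (x : 'rV[R]_d) (i j : 'I_d) (r : R) : Ck_on 2 U f ->
  (forall a b : R, 0 <= a <= r -> 0 <= b <= r -> U (x + a *: e i + b *: e j)) ->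
  0 <= r ->
  exists a b : R, [/\ 0 <= a <= r, 0 <= b <= r &
    f (x + r *: e i + r *: e j) - f (x + r *: e i) - (f (x + r *: e j) - f x)
    = r * (r * partial j (partial i f) (x + a *: e i + b *: e j))].
Proof.
move=> [df d2] Usq r0.
have sc (c : R) : 0 <= c <= 1 -> 0 <= c * r <= r.
  by move=> /andP[c0 c1]; rewrite mulr_ge0 //= ler_piMl.
have rr : 0 <= r <= r by rewrite r0 lexx.
have U0 (a : R) : 0 <= a <= r -> U (x + a *: e i).
  by move=> ha; have := Usq a 0 ha; rewrite scale0r addr0; apply; rewrite lexx.
pose G (z : 'rV[R]_d) := f (z + r *: e j) - f z.
have dG (c : R) : 0 <= c <= 1 -> is_derive (x + (c * r) *: e i) (e i) G
   (partial i f (x + (c * r) *: e i + r *: e j) - partial i f (x + (c * r) *: e i)).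
  move=> c01; apply: is_deriveB.
    by apply: is_derive_translate; apply: df; apply: Usq; [exact: sc|].
  by apply: derivableP; apply: df; apply: U0; exact: sc.
have [|c c01 E1] := @MVT_line _ G x (e i) r.
  by move=> c c01; case: (dG c c01).
have [|b b01 E2] := @MVT_line _ (partial i f) (x + (c * r) *: e i) (e j) r.
  by move=> b b01; apply: (d2 i).1; apply: Usq; exact: sc.
exists (c * r), (b * r); split; [exact: sc|exact: sc|].
rewrite -E2; have := dG c c01 => -[_ <-].
by rewrite -E1.
Qed.

Lemma ball_continuous2 U (f g : 'rV[R]_d -> R) x : open U -> U x ->
  {for x, continuous f} -> {for x, continuous g} ->
  forall eps : R, 0 < eps -> exists2 del : R, 0 < del & forall z, ball x del z ->
    [/\ U z, `|f x - f z| <= eps & `|g x - g z| <= eps].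
Proof.
move=> oU Ux /cvgrPdist_le cf /cvgrPdist_le cg eps eps0.
have nfg := @filterI _ _ (nbhs_filter x) _ _ (cf _ eps0) (cg _ eps0).
have := @filterI _ _ (nbhs_filter x) _ _ (open_nbhs_nbhs (conj oU Ux)) nfg.
move=> /nbhs_ballP [del /= del0 H]; exists del => // z /H [? [? ?]]; split => //.
Qed.

Lemma dist_half_trans (p q u eps : R) :
  `|p - u| <= eps / 2 -> `|q - u| <= eps / 2 -> `|p - q| <= eps.
Proof.
move=> pu qu; rewrite (splitr eps) -(subrKA u); apply: le_trans (ler_normD _ _) _.
by apply: lerD => //; rewrite distrC.
Qed.

(** The second difference is symmetric in [i] and [j], and by [second_difference] it computes
    either mixed derivative at points close to [x]. *)
Lemma schwarz U f (x : 'rV[R]_d) (i j : 'I_d) : open U -> U x -> Ck_on 2 U f ->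
  partial i (partial j f) x = partial j (partial i f) x.
Proof.
move=> oU Ux Cf; have [df d2] := Cf.
apply/eqP; rewrite -subr_eq0 -normr_le0; apply/ler_addgt0Pl => eps eps0; rewrite addr0.
have e20 : 0 < eps / 2 by rewrite divr_gt0.
have [del del0 Hdel] := ball_continuous2 oU Ux ((d2 i).2 j x Ux) ((d2 j).2 i x Ux) e20.
pose r := del / 3.
have r0 : 0 < r by rewrite divr_gt0.
have sq (k l : 'I_d) (a b : R) : 0 <= a <= r -> 0 <= b <= r -> ball x del (x + a *: e k + b *: e l).
  move=> /andP[a0 ar] /andP[b0 br]; rewrite -ball_normE /= -addrA opprD addNKr normrN.
  apply: le_lt_trans (ler_normD _ _) _; rewrite !delta_normE !ger0_norm //.
  apply: (@le_lt_trans _ _ (r + r)); first exact: lerD.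
  by rewrite /r; lra.
have [a [b [ha hb E1]]] := @second_difference U f x i j r Cf
  (fun a b ha hb => let: And3 H _ _ := Hdel _ (sq i j a b ha hb) in H) (ltW r0).
have [a' [b' [ha' hb' E2]]] := @second_difference U f x j i r Cf
  (fun a b ha hb => let: And3 H _ _ := Hdel _ (sq j i a b ha hb) in H) (ltW r0).
have E : partial j (partial i f) (x + a *: e i + b *: e j) =
         partial i (partial j f) (x + a' *: e j + b' *: e i).
  have sw (p q u v : R) : p - q - (u - v) = p - u - (q - v) by ring.
  apply: (mulfI (lt0r_neq0 r0)); apply: (mulfI (lt0r_neq0 r0)).
  apply: (etrans (esym E1)); apply: etrans E2.
  by rewrite (addrAC x (r *: e j)); exact: sw.
have [_ H1 _] := Hdel _ (sq i j a b ha hb).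
have [_ _ H2] := Hdel _ (sq j i a' b' ha' hb').
have H1' := eq_ind _ (fun w => is_true (`|partial j (partial i f) x - w| <= eps / 2)) H1 _ E.
exact: (dist_half_trans H2 H1').
Qed.

End RealCalculus.

(** * Derivatives of complex matrix valued maps *)

Section ComplexDerivatives.
Variable R : realType.
Local Notation C := R[i].
Variable V : normedModType R.
Implicit Types (x v : V).

(** [R[i]] is a normed module over itself only, so real differentiability of a complex valued map
    is expressed through its real and imaginary parts. *)
Definition is_cderive x v (f : V -> C) (df : C) : Prop :=
  is_derive x v (fun z => complex.Re (f z)) (complex.Re df) /\
  is_derive x v (fun z => complex.Im (f z)) (complex.Im df).

Definition is_mxderive m n x v (F : V -> 'M[C]_(m, n)) (dF : 'M[C]_(m, n)) : Prop :=
  forall i j, is_cderive x v (fun z => F z i j) (dF i j).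

Lemma ReD (a b : C) : complex.Re (a + b) = complex.Re a + complex.Re b.
Proof. by case: a b => ? ? []. Qed.
Lemma ImD (a b : C) : complex.Im (a + b) = complex.Im a + complex.Im b.
Proof. by case: a b => ? ? []. Qed.
Lemma ReN (a : C) : complex.Re (- a) = - complex.Re a.
Proof. by case: a. Qed.
Lemma ImN (a : C) : complex.Im (- a) = - complex.Im a.
Proof. by case: a. Qed.
Lemma ReM (a b : C) :
  complex.Re (a * b) = complex.Re a * complex.Re b - complex.Im a * complex.Im b.
Proof. by case: a b => ? ? []. Qed.
Lemma ImM (a b : C) :
  complex.Im (a * b) = complex.Re a * complex.Im b + complex.Im a * complex.Re b.
Proof. by case: a b => ? ? []. Qed.
Lemma Re_conj (a : C) : complex.Re (Num.conj a) = complex.Re a.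
Proof. by case: a. Qed.
Lemma Im_conj (a : C) : complex.Im (Num.conj a) = - complex.Im a.
Proof. by case: a. Qed.
Lemma Re_sum I (r : seq I) P (F : I -> C) :
  complex.Re (\sum_(i <- r | P i) F i) = \sum_(i <- r | P i) complex.Re (F i).
Proof. by apply: (big_morph _ ReD). Qed.
Lemma Im_sum I (r : seq I) P (F : I -> C) :
  complex.Im (\sum_(i <- r | P i) F i) = \sum_(i <- r | P i) complex.Im (F i).
Proof. by apply: (big_morph _ ImD). Qed.
Lemma Re_rM (r : R) (a : C) : complex.Re (r%:C%C * a) = r * complex.Re a.
Proof. by rewrite ReM /= mul0r subr0. Qed.
Lemma Im_rM (r : R) (a : C) : complex.Im (r%:C%C * a) = r * complex.Im a.
Proof. by rewrite ImM /= mul0r addr0. Qed.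
Lemma complex_eq (a b : C) : complex.Re a = complex.Re b ->
  complex.Im a = complex.Im b -> a = b.
Proof. by case: a b => ? ? [? ?] /= -> ->. Qed.

Lemma is_cderive_cst x v (c : C) : is_cderive x v (fun=> c) 0.
Proof. by split; exact: is_derive_cst. Qed.

Lemma is_cderive_eq x v f (d d' : C) : is_cderive x v f d -> d = d' -> is_cderive x v f d'.
Proof. by move=> h <-. Qed.

Lemma is_cderive_ext x v (f g : V -> C) d : f =1 g -> is_cderive x v f d -> is_cderive x v g d.
Proof. by move=> /funext <-. Qed.

Lemma is_cderive_conj x v f d : is_cderive x v f d ->
  is_cderive x v (fun z => Num.conj (f z)) (Num.conj d).
Proof.
move=> [h1 h2]; split.
  rewrite Re_conj (_ : (fun _ => _) = (fun z => complex.Re (f z))) //.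
  by apply/funext => z; rewrite Re_conj.
rewrite Im_conj (_ : (fun _ => _) = - (fun z => complex.Im (f z))); first exact: is_deriveN.
by apply/funext => z; rewrite Im_conj.
Qed.

Lemma is_cderiveD x v f g d e : is_cderive x v f d -> is_cderive x v g e ->
  is_cderive x v (fun z => f z + g z) (d + e).
Proof.
move=> [h1 h2] [h3 h4]; split.
  rewrite ReD (_ : (fun _ => _) = (fun z => complex.Re (f z)) + (fun z => complex.Re (g z))).
    exact: is_deriveD.
  by apply/funext => z; rewrite ReD.
rewrite ImD (_ : (fun _ => _) = (fun z => complex.Im (f z)) + (fun z => complex.Im (g z))).
  exact: is_deriveD.
by apply/funext => z; rewrite ImD.
Qed.

Lemma is_cderiveM x v f g d e : is_cderive x v f d -> is_cderive x v g e ->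
  is_cderive x v (fun z => f z * g z) (d * g x + f x * e).
Proof.
move=> [h1 h2] [h3 h4]; split.
  rewrite (_ : (fun _ => _) = (fun z => complex.Re (f z)) * (fun z => complex.Re (g z))
     - (fun z => complex.Im (f z)) * (fun z => complex.Im (g z))); last first.
    by apply/funext => z; rewrite ReM.
  apply: is_derive_eq; rewrite ReD !ReM /GRing.scale /=; ring.
rewrite (_ : (fun _ => _) = (fun z => complex.Re (f z)) * (fun z => complex.Im (g z))
     + (fun z => complex.Im (f z)) * (fun z => complex.Re (g z))); last first.
  by apply/funext => z; rewrite ImM.
apply: is_derive_eq; rewrite ImD !ImM /GRing.scale /=; ring.
Qed.

Lemma is_cderive_sum x v (I : eqType) (r : seq I) (f : I -> V -> C) (d : I -> C) :
  (forall i, i \in r -> is_cderive x v (f i) (d i)) ->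
  is_cderive x v (fun z => \sum_(i <- r) f i z) (\sum_(i <- r) d i).
Proof.
elim: r => [|i r IH] h.
  rewrite big_nil; apply: is_cderive_ext (is_cderive_cst x v 0) => z.
  by rewrite big_nil.
rewrite big_cons.
have h1 := is_cderiveD (h i (mem_head _ _)) (IH (fun j hj => h j (mem_behead (s := i :: r) hj))).
by apply: is_cderive_ext h1 => z; rewrite big_cons.
Qed.

Lemma is_cderive_real x v (f : V -> R) d : is_derive x v f d ->
  is_cderive x v (fun z => (f z)%:C%C) d%:C%C.
Proof. by move=> h; split => //=; exact: is_derive_cst. Qed.

Lemma is_cderive_unique x v f d e : is_cderive x v f d -> is_cderive x v f e -> d = e.
Proof.
move=> [[_ h1] [_ h2]] [[_ h3] [_ h4]]; apply: complex_eq.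
  by rewrite -h1 -h3.
by rewrite -h2 -h4.
Qed.

Lemma is_cderive_near x v f g d : (\near x, f x = g x) -> is_cderive x v f d ->
  is_cderive x v g d.
Proof.
move=> fg [h1 h2]; split; [apply: near_eq_is_derive h1|apply: near_eq_is_derive h2];
 by apply: filterS fg => z ->.
Qed.

Section Mx.
Variables (x v : V).

Lemma is_mxderive_cst m n (A : 'M[C]_(m, n)) : is_mxderive x v (fun=> A) 0.
Proof. by move=> i j; rewrite mxE; exact: is_cderive_cst. Qed.

Lemma is_mxderive_ext m n (F G : V -> 'M[C]_(m, n)) D : F =1 G ->
  is_mxderive x v F D -> is_mxderive x v G D.
Proof. by move=> /funext <-. Qed.

Lemma is_mxderive_unique m n (F : V -> 'M[C]_(m, n)) D E :
  is_mxderive x v F D -> is_mxderive x v F E -> D = E.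
Proof. by move=> h1 h2; apply/matrixP => i j; exact: is_cderive_unique (h1 i j) (h2 i j). Qed.

Lemma is_mxderive_near m n (F G : V -> 'M[C]_(m, n)) D :
  (\near x, F x = G x) -> is_mxderive x v F D -> is_mxderive x v G D.
Proof.
move=> FG h i j; apply: is_cderive_near (h i j).
by apply: filterS FG => z ->.
Qed.

Lemma is_mxderiveM m n p (F : V -> 'M[C]_(m, n)) (G : V -> 'M[C]_(n, p)) D E :
  is_mxderive x v F D -> is_mxderive x v G E ->
  is_mxderive x v (fun z => F z *m G z) (D *m G x + F x *m E).
Proof.
move=> h1 h2 i j.
apply: is_cderive_ext (is_cderive_eq (is_cderive_sum (r := index_enum 'I_n)
   (fun k _ => is_cderiveM (h1 i k) (h2 k j))) _) => [z|].
  by rewrite mxE.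
by rewrite !mxE -big_split.
Qed.

Lemma is_mxderive_adj m n (F : V -> 'M[C]_(m, n)) D :
  is_mxderive x v F D -> is_mxderive x v (fun z => (F z)^t*%sesqui) (D^t*%sesqui).
Proof.
move=> h i j; rewrite !mxE; apply: is_cderive_ext (is_cderive_conj (h j i)) => z.
by rewrite !mxE.
Qed.

Lemma is_mxderiveZ m n (f : V -> R) d (F : V -> 'M[C]_(m, n)) D :
  is_derive x v f d -> is_mxderive x v F D ->
  is_mxderive x v (fun z => (f z)%:C%C *: F z) (d%:C%C *: F x + (f x)%:C%C *: D).
Proof.
move=> h1 h2 i j.
apply: is_cderive_ext (is_cderive_eq (is_cderiveM (is_cderive_real h1) (h2 i j)) _) => [z|].
  by rewrite mxE.
by rewrite !mxE.
Qed.

Lemma is_mxderive_sum m n (I : eqType) (r : seq I) (F : I -> V -> 'M[C]_(m, n)) D :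
  (forall i, i \in r -> is_mxderive x v (F i) (D i)) ->
  is_mxderive x v (fun z => \sum_(i <- r) F i z) (\sum_(i <- r) D i).
Proof.
move=> h i j; rewrite summxE.
apply: is_cderive_ext (is_cderive_sum (fun k hk => h k hk i j)) => z.
by rewrite summxE.
Qed.

End Mx.
End ComplexDerivatives.

(** * Exponentials of skew-Hermitian matrices *)

Section Exponential.
Variable R : realType.
Local Notation C := R[i].

Definition cis (t : R) : C := (cos t +i* sin t)%C.

Lemma cis0 : cis 0 = 1.
Proof. by rewrite /cis cos0 sin0. Qed.

Lemma cisD s t : cis (s + t) = cis s * cis t.
Proof. by apply: complex_eq; rewrite ?ReM ?ImM /= ?cosD ?sinD; ring. Qed.

Lemma conj_cis t : Num.conj (cis t) = cis (- t).
Proof. by apply: complex_eq; rewrite ?Re_conj ?Im_conj /= ?cosN ?sinN. Qed.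

Lemma cis_sum (I : Type) (r : seq I) (P : pred I) (F : I -> R) :
  \prod_(i <- r | P i) cis (F i) = cis (\sum_(i <- r | P i) F i).
Proof. by rewrite (big_morph _ cisD cis0). Qed.

Lemma is_cderive_cis (th t : R) :
  is_cderive t 1 (fun t => cis (t * th)) ((0 +i* th)%C * cis (t * th)).
Proof.
have dm : is_derive t 1 (fun c : R => c * th) th.
  have -> : (fun c : R => c * th) = th \*: id by apply/funext => z /=; rewrite mulrC.
  by apply: is_derive_eq; rewrite [_ *: _]mulr1.
split; rewrite ?ReM ?ImM /= ?mul0r ?sub0r ?add0r ?addr0.
  apply: is_derive_eq (@is_derive1_comp _ cos (fun c => c * th) _ _ _ (is_derive_cos _) dm) _.
  by rewrite mulNr mulrC.
apply: is_derive_eq (@is_derive1_comp _ sin (fun c => c * th) _ _ _ (is_derive_sin _) dm) _.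
by rewrite mulrC.
Qed.

Lemma imaginary_expr (x : R) (k : nat) :
  ((0 +i* x)%C : C) ^+ k =
  (((~~ odd k)%:R * (-1) ^+ k./2 * x ^+ k : R) +i* ((odd k)%:R * (-1) ^+ k.-1./2 * x ^+ k : R))%C.
Proof.
elim: k => [|k IH]; first by rewrite /= !expr0 !mulr1.
rewrite exprS IH; apply: complex_eq; rewrite ?ReM ?ImM /= mul0r ?sub0r ?add0r ?addr0 ?negbK.
  case: (boolP (odd k)) => ok; last by rewrite !mul0r mulr0 oppr0.
  case: k ok {IH} => // k /= _.
  by rewrite !mul1r !exprS; ring.
case: (odd k); rewrite ?mul0r ?mulr0 //=.
by rewrite exprS; ring.
Qed.

(** Euler's formula, for the partial sums of the exponential series at [i x]. *)
Lemma cvg_exp_series (x : R) :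
  (\sum_(k < N) complex.Re ((k`!%:R)^-1 * (0 +i* x)%C ^+ k)) @[N --> \oo] --> cos x /\
  (\sum_(k < N) complex.Im ((k`!%:R)^-1 * (0 +i* x)%C ^+ k)) @[N --> \oo] --> sin x.
Proof.
have fE (k : nat) : ((k`!%:R)^-1 : C) = ((k`!%:R)^-1 : R)%:C%C.
  by rewrite -[X in X^-1 = _](rmorph_nat (real_complex R)) fmorphV.
split.
  rewrite (_ : (fun N => _) = series (cos_coeff x)).
    by rewrite cos.unlock; exact: is_cvg_series_cos_coeff.
  apply/funext => N; rewrite /series /= big_mkord; apply: eq_bigr => k _.
  by rewrite fE Re_rM imaginary_expr /= mulrC.
rewrite (_ : (fun N => _) = series (sin_coeff x)).
  by rewrite sin.unlock; exact: is_cvg_series_sin_coeff.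
apply/funext => N; rewrite /series /= big_mkord; apply: eq_bigr => k _.
by rewrite fE Im_rM imaginary_expr /= mulrC.
Qed.

Lemma adjmxE m n (A : 'M[C]_(m, n)) i j : (A^t*) i j = Num.conj (A j i).
Proof. by rewrite mxE mxE. Qed.

(** A skew-Hermitian matrix is normal, and its eigenvalues are purely imaginary. *)
Lemma skew_spectral n (A : 'M[C]_n) : skewhermitian A ->
  exists (P : 'M[C]_n) (th : 'I_n -> R), P \is unitarymx /\
    A = P^t* *m diag_mx (\row_j (0 +i* th j)%C) *m P.
Proof.
move=> sA.
have nA : A \is normalmx by apply/normalmxP; rewrite sA mulmxN mulNmx.
have /orthomx_spectralP := nA.
set P := spectralmx A; set D := spectral_diag A => EA.
have uP : P \is unitarymx by exact: spectral_unitarymx.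
rewrite invmx_unitary // in EA.
have ED : diag_mx D = P *m A *m P^t*.
  by rewrite EA !mulmxA mulmxtVK // (unitarymxP uP) mul1mx.
have DN : (diag_mx D)^t* = - diag_mx D.
  rewrite ED !trmx_mul !map_mxM trmxCK -/(A^t*) sA -mulNmx mulmxA -mulmxN //.
have DE : D = \row_j (0 +i* complex.Im (D 0 j))%C.
  apply/rowP => j; rewrite mxE.
  have := congr1 (fun X : 'M[C]_n => X j j) DN; rewrite adjmxE !mxE eqxx !mulr1n => H.
  apply: complex_eq => //=.
  by have := congr1 (@complex.Re R) H; rewrite Re_conj ReN; lra.
exists P, (fun j => complex.Im (D 0 j)); split; first exact: uP.
by rewrite -DE.
Qed.

(** The functional calculus of a normal matrix: applying a function to the matrix amounts to applying
    it to the eigenvalues [d] while [P] stays fixed. *)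
Definition conj_diag n (P : 'M[C]_n) (d : 'I_n -> C) : 'M[C]_n :=
  P^t* *m diag_mx (\row_j d j) *m P.

Lemma conj_diagE n (P : 'M[C]_n) d a b :
  conj_diag P d a b = \sum_j d j * (Num.conj (P j a) * P j b).
Proof.
rewrite /conj_diag mul_mx_diag mxE; apply: eq_bigr => j _; rewrite !mxE.
by rewrite mulrAC mulrC.
Qed.

Lemma conj_diagM n (P : 'M[C]_n) d e : P \is unitarymx ->
  conj_diag P d *m conj_diag P e = conj_diag P (fun j => d j * e j).
Proof.
move=> /unitarymxP uP.
have DE : diag_mx (\row_j d j) *m diag_mx (\row_j e j) = diag_mx (\row_j (d j * e j)) :> 'M[C]_n.
  by rewrite mulmx_diag; congr diag_mx; apply/rowP => j; rewrite !mxE.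
rewrite /conj_diag -DE; set D := diag_mx (\row_j d j); set E := diag_mx (\row_j e j).
rewrite -(mulmxA (P^t* *m D) P) (mulmxA P (P^t* *m E)) (mulmxA P (P^t*) E) uP mul1mx.
by rewrite mulmxA -(mulmxA (P^t*) D E).
Qed.

Lemma conj_diag1 n (P : 'M[C]_n) : P \is unitarymx -> conj_diag P (fun=> 1) = 1%:M.
Proof.
move=> uP; rewrite /conj_diag (_ : \row__ _ = const_mx 1); last by apply/rowP => j; rewrite !mxE.
by rewrite diag_const_mx mulmx1; apply: mulmx1C; apply/unitarymxP.
Qed.

Lemma mul_conj_diag n (P : 'M[C]_n) d : P \is unitarymx ->
  P *m conj_diag P d = diag_mx (\row_j d j) *m P.
Proof.
move=> /unitarymxP uP; rewrite /conj_diag; set D := diag_mx _.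
by rewrite -(mulmxA _ D P) mulmxA uP mul1mx.
Qed.

Lemma det_conj_diag n (P : 'M[C]_n) d : P \is unitarymx ->
  \det (conj_diag P d) = \prod_j d j.
Proof.
move=> uP; rewrite /conj_diag det_mulmx mulrC -det_mulmx mulmxA.
rewrite (unitarymxP uP) mul1mx det_diag; apply: eq_bigr => j _; by rewrite mxE.
Qed.

Lemma trace_conj_diag n (P : 'M[C]_n) d : P \is unitarymx ->
  \tr (conj_diag P d) = \sum_j d j.
Proof.
move=> uP; rewrite /conj_diag mxtrace_mulC mulmxA (unitarymxP uP) mul1mx mxtrace_diag.
by apply: eq_bigr => j _; rewrite mxE.
Qed.

Local Opaque conj_diag.

Lemma conj_diag_adj n (P : 'M[C]_n) d :
  (conj_diag P d)^t* = conj_diag P (fun j => Num.conj (d j)).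
Proof.
have cE (x y z : C) : Num.conj (x * (Num.conj y * z)) = Num.conj x * (Num.conj z * y).
  by apply: complex_eq; rewrite ?(Re_conj, ReM, Im_conj, ImM); ring.
apply/matrixP => a b; rewrite adjmxE (conj_diagE P d) (conj_diagE P (fun j => _)) rmorph_sum.
by apply: eq_bigr => j _; exact: cE.
Qed.

Lemma conj_diagZ n (P : 'M[C]_n) d c :
  c *: conj_diag P d = conj_diag P (fun j => c * d j).
Proof.
apply/matrixP => a b; rewrite mxE !conj_diagE mulr_sumr; apply: eq_bigr => j _.
by rewrite mulrA.
Qed.

Lemma conj_diagX n (P : 'M[C]_n) d k : P \is unitarymx ->
  conj_diag P d ^+ k = conj_diag P (fun j => d j ^+ k).
Proof.
move=> uP; elim: k => [|k IH]; first by rewrite (_ : (fun j => d j ^+ 0) = fun=> 1) ?conj_diag1.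
rewrite exprS IH; apply: etrans (conj_diagM _ _ uP) _; congr conj_diag.
by apply/funext => j; rewrite exprS.
Qed.

(** The powers of a matrix in spectral form are in spectral form, so the exponential series is
    summed eigenvalue by eigenvalue. *)
Lemma expmx_spectral n (P : 'M[C]_n) (th : 'I_n -> R) (t : R) : P \is unitarymx ->
  expmx (t%:C%C *: conj_diag P (fun j => (0 +i* th j)%C)) =
  conj_diag P (fun j => cis (t * th j)).
Proof.
move=> uP; apply/matrixP => a b; rewrite mxE.
have SE N : (\sum_(k < N) (k`!%:R)^-1 *: (t%:C%C *: conj_diag P (fun j => (0 +i* th j)%C)) ^+ k) a b
  = \sum_j (\sum_(k < N) (k`!%:R)^-1 * (0 +i* (t * th j))%C ^+ k) * (Num.conj (P j a) * P j b).
  rewrite summxE; under [RHS]eq_bigr do rewrite mulr_suml.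
  rewrite exchange_big; apply: eq_bigr => k _.
  rewrite conj_diagZ (_ : (fun j => _ * _) = fun j => (0 +i* (t * th j))%C); last first.
    by apply/funext => j; apply: complex_eq; rewrite ?Re_rM ?Im_rM /= ?mulr0.
  by rewrite conj_diagX // conj_diagZ conj_diagE.
rewrite conj_diagE; apply: complex_eq => /=.
  apply: cvg_lim => //; rewrite Re_sum.
  under eq_fun do rewrite SE Re_sum.
  apply: cvg_sumr => j _.
  under eq_fun do rewrite ReM Re_sum Im_sum.
  rewrite ReM /=; have [h1 h2] := cvg_exp_series (t * th j).
  by apply: cvgB; apply: cvgM => //; exact: cvg_cst.
apply: cvg_lim => //; rewrite Im_sum.
under eq_fun do rewrite SE Im_sum.
apply: cvg_sumr => j _.
under eq_fun do rewrite ImM Re_sum Im_sum.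
rewrite ImM /=; have [h1 h2] := cvg_exp_series (t * th j).
by apply: cvgD; apply: cvgM => //; exact: cvg_cst.
Qed.

(** All later facts about exponentials are read off from this closed form. *)
Lemma expmx_skewP n (A : 'M[C]_n) : skewhermitian A ->
  exists (P : 'M[C]_n) (th : 'I_n -> R), [/\ P \is unitarymx,
    A = conj_diag P (fun j => (0 +i* th j)%C) &
    forall t : R, expmx (t%:C%C *: A) = conj_diag P (fun j => cis (t * th j))].
Proof.
move=> /skew_spectral [P [th [uP EA]]]; exists P, th; split; [exact: uP|exact: EA|].
by move=> t; rewrite EA; exact: expmx_spectral.
Qed.

Lemma unitary_conj_diag_cis n (P : 'M[C]_n) (u : 'I_n -> R) : P \is unitarymx ->
  conj_diag P (fun j => cis (u j)) \is unitarymx.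
Proof.
move=> uP; apply/unitarymxP; rewrite conj_diag_adj conj_diagM // -(conj_diag1 uP).
by congr conj_diag; apply/funext => j; rewrite conj_cis -cisD subrr cis0.
Qed.

Section Properties.
Variables (n : nat) (A : 'M[C]_n) (sA : skewhermitian A).

Lemma SU_expmx t : \tr A = 0 -> SU (expmx (t%:C%C *: A)).
Proof.
have [P [th [uP EA Eexp]]] := expmx_skewP sA; move=> trA.
rewrite Eexp; split; first exact: unitary_conj_diag_cis.
rewrite det_conj_diag // cis_sum -mulr_sumr.
have : \sum_j (0 +i* th j)%C = 0 :> C by rewrite -(trace_conj_diag _ uP) -EA.
move=> /(congr1 (@complex.Im R)); rewrite Im_sum /= => ->.
by rewrite mulr0 cis0.
Qed.

Lemma expmx0 : expmx ((0 : R)%:C%C *: A) = 1%:M.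
Proof.
have [P [th [uP EA Eexp]]] := expmx_skewP sA.
rewrite Eexp -(conj_diag1 uP); congr conj_diag; apply/funext => j.
by rewrite mul0r cis0.
Qed.

Lemma is_mxderive_expmx (t : R) :
  is_mxderive t 1 (fun t : R => expmx (t%:C%C *: A)) (A *m expmx (t%:C%C *: A)).
Proof.
have [P [th [uP EA Eexp]]] := expmx_skewP sA.
move=> a b.
have -> : (A *m expmx (t%:C%C *: A)) a b =
    \sum_j (0 +i* th j)%C * cis (t * th j) * (Num.conj (P j a) * P j b).
  by rewrite Eexp {1}EA conj_diagM // conj_diagE.
under eq_fun do rewrite Eexp conj_diagE.
apply: is_cderive_sum => j _.
apply: is_cderive_eq (is_cderiveM (is_cderive_cis _ _) (is_cderive_cst _ _ _)) _.
by rewrite mulr0 addr0.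
Qed.

Lemma expmx_comm (t : R) : A *m expmx (t%:C%C *: A) = expmx (t%:C%C *: A) *m A.
Proof.
have [P [th [uP EA Eexp]]] := expmx_skewP sA.
have h1 : A *m expmx (t%:C%C *: A) = conj_diag P (fun j => (0 +i* th j)%C * cis (t * th j)).
  by rewrite Eexp {1}EA conj_diagM.
have -> : expmx (t%:C%C *: A) *m A = conj_diag P (fun j => cis (t * th j) * (0 +i* th j)%C).
  by rewrite Eexp {1}EA conj_diagM.
by rewrite h1; congr conj_diag; apply/funext => j; rewrite mulrC.
Qed.

End Properties.

End Exponential.

(** * The Killing form and the invariant metrics *)

Local Opaque conj_diag.

Section KillingForm.
Variables (R : realType) (n : nat).
Local Notation C := R[i].
Local Notation M := 'M[C]_n.
Implicit Types (X Y Z P Q : M) (lam : 'I_n -> 'I_n -> R).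

Lemma ad_is_linear X : linear (ad X).
Proof. by move=> a P Q; rewrite /ad linearP /= mulmxDl -scalemxAl scalerBr opprD addrACA. Qed.

HB.instance Definition _ X := GRing.isLinear.Build C M M _ (ad X) (@ad_is_linear X).

(** The trace is computed in the basis of elementary matrices. *)
Lemma trace_lin_mxM (f g : {linear M -> M}) :
  \tr (lin_mx f *m lin_mx g) = \sum_i \sum_j g (f (delta_mx i j)) i j.
Proof.
rewrite /mxtrace (reindex _ (curry_mxvec_bij n n)) /=.
rewrite (eq_bigr (fun p : 'I_n * 'I_n => g (f (delta_mx p.1 p.2)) p.1 p.2)).
  by rewrite -(pair_bigA _ (fun i j => g (f (delta_mx i j)) i j)).
move=> [i j] _ /=; set k := mxvec_index i j.
have -> : (lin_mx f *m lin_mx g) k k = ((delta_mx 0 k : 'rV[C]_(n * n)) *m (lin_mx f *m lin_mx g)) 0 k.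
  by rewrite -rowE [RHS]mxE.
by rewrite mulmxA -mxvec_delta !mul_vec_lin mxvecE.
Qed.

Lemma trace_ad X Y :
  \tr (lin_mx (ad X) *m lin_mx (ad Y)) = (\tr (X *m Y) *+ n - \tr X * \tr Y) *+ 2.
Proof.
rewrite trace_lin_mxM.
have dl (A : M) (i j : 'I_n) : (A *m (delta_mx i j : M)) i j = A i i.
  by rewrite mxE (bigD1 i) //= big1 ?addr0 => [|k /negbTE ki]; rewrite mxE ?ki ?eqxx ?mulr1 ?mulr0.
have dr (A : M) (i j : 'I_n) : ((delta_mx i j : M) *m A) i j = A j j.
  by rewrite mxE (bigD1 j) //= big1 ?addr0 => [|k /negbTE ki]; rewrite mxE ?ki ?eqxx ?mul1r ?andbF ?mul0r.
have dlr (A B : M) (i j : 'I_n) : (A *m (delta_mx i j : M) *m B) i j = A i i * B j j.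
  rewrite mxE (bigD1 j) //= big1 ?addr0 => [|k kj].
    by rewrite dl.
  rewrite mxE big1 ?mul0r // => l _; by rewrite mxE (negbTE kj) andbF mulr0.
have E i j : ad Y (ad X (delta_mx i j)) i j =
    (Y *m X) i i - Y i i * X j j - X i i * Y j j + (X *m Y) j j.
  rewrite -(dl (Y *m X) i j) -(dr (X *m Y) i j) -(dlr Y X i j) -(dlr X Y).
  rewrite /ad mulmxBr mulmxBl !mulmxA opprB addrA.
  have mxEB (P Q : M) : (P - Q) i j = P i j - Q i j by rewrite !mxE.
  have mxED (P Q : M) : (P + Q) i j = P i j + Q i j by rewrite !mxE.
  by rewrite mxEB mxED mxEB; ring.
under eq_bigr do under eq_bigr do rewrite E.
rewrite (eq_bigr (fun i => (Y *m X) i i *+ n - Y i i * \tr X - X i i * \tr Y + \tr (X *m Y))); last first.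
  move=> i _; rewrite big_split /= sumrB sumrB sumr_const card_ord.
  by rewrite -!mulr_sumr.
rewrite big_split /= sumrB sumrB sumr_const card_ord -!mulr_suml sumrMnl.
rewrite -/(\tr (Y *m X)) -/(\tr X) -/(\tr Y) [\tr (Y *m X)]mxtrace_mulC; ring.
Qed.

(** The zero diagonal does the work of the projection onto m. *)
Definition offdiag_coef lam (a b : 'I_n) : R := if a == b then 0 else lam a b.

(** The inner product of an invariant metric, extended to all matrices through the projection
    onto m; the factor 2n comes from the Killing form. *)
Definition bform lam P Q : R :=
  - (complex.Re (\sum_a \sum_b (offdiag_coef lam a b)%:C%C * (P a b * Q b a)) *+ n *+ 2).

Lemma killing_m_proj lam P Q :
  killing (metric_op lam (m_proj P)) (m_proj Q) = - bform lam P Q.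
Proof.
rewrite /killing trace_ad /bform opprK.
have -> : \tr (m_proj Q) = 0.
  by rewrite /mxtrace big1 // => i _; rewrite mxE eqxx.
rewrite mulr0 subr0.
have ReMn (z : C) k : complex.Re (z *+ k) = complex.Re z *+ k.
  by elim: k => [|k IH]; rewrite ?mulr0n // !mulrSr ReD IH.
rewrite !ReMn; congr (complex.Re _ *+ _ *+ _).
apply: eq_bigr => a _; rewrite mxE; apply: eq_bigr => b _.
rewrite !mxE /offdiag_coef [b == a]eq_sym; case: eqP => _; first by rewrite !mulr0 mul0r.
by rewrite mulrA.
Qed.

Lemma inv_metricE lam (g V W : M) :
  inv_metric lam g V W = bform lam (g^t* *m V) (g^t* *m W).
Proof. by rewrite /inv_metric /to_origin killing_m_proj opprK. Qed.

Section BilinearForm.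
Variable lam : 'I_n -> 'I_n -> R.
Hypothesis lamP : metric_coefs lam.
Local Notation mu := (offdiag_coef lam).

Lemma offdiag_coef_sym a b : mu a b = mu b a.
Proof. by rewrite /offdiag_coef eq_sym; case: eqP => // _; case: lamP. Qed.

Lemma bform_real P Q : bform lam P Q =
  - (\sum_a \sum_b mu a b * complex.Re (P a b * Q b a)) *+ n *+ 2.
Proof.
rewrite /bform -!mulNrn Re_sum; congr (- _ *+ _ *+ _); apply: eq_bigr => a _.
by rewrite Re_sum; apply: eq_bigr => b _; rewrite Re_rM.
Qed.

Lemma bformC P Q : bform lam P Q = bform lam Q P.
Proof.
rewrite !bform_real exchange_big /=; congr (- _ *+ _ *+ _).
apply: eq_bigr => a _; apply: eq_bigr => b _.
by rewrite offdiag_coef_sym mulrC [Q a b * _]mulrC mulrC.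
Qed.

Lemma bform_eqr P Q Q' : (forall a b, a != b -> Q a b = Q' a b) ->
  bform lam P Q = bform lam P Q'.
Proof.
move=> QQ; rewrite !bform_real; congr (- _ *+ _ *+ _).
apply: eq_bigr => a _; apply: eq_bigr => b _; rewrite /offdiag_coef.
by case: (eqVneq a b) => [_|ab]; rewrite ?mul0r // QQ // eq_sym.
Qed.

Lemma bform_eql P P' Q : (forall a b, a != b -> P a b = P' a b) ->
  bform lam P Q = bform lam P' Q.
Proof. by move=> PP; rewrite bformC (bform_eqr _ PP) bformC. Qed.

Lemma bformDl P P' Q : bform lam (P + P') Q = bform lam P Q + bform lam P' Q.
Proof.
rewrite !bform_real -!mulrnDl -opprD -big_split; congr (- _ *+ _ *+ _).
apply: eq_bigr => a _; rewrite -big_split; apply: eq_bigr => b _ /=.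
by rewrite mxE mulrDl ReD mulrDr.
Qed.

Lemma bformDr P Q Q' : bform lam P (Q + Q') = bform lam P Q + bform lam P Q'.
Proof. by rewrite bformC bformDl !(bformC P). Qed.

Lemma bformZl (r : R) P Q : bform lam (r%:C%C *: P) Q = r * bform lam P Q.
Proof.
rewrite !bform_real !mulrnAr; congr (_ *+ _ *+ _).
rewrite mulrN mulr_sumr; congr (- _).
apply: eq_bigr => a _; rewrite mulr_sumr; apply: eq_bigr => b _ /=.
by rewrite mxE -mulrA Re_rM mulrCA.
Qed.

Lemma bformZr (r : R) P Q : bform lam P (r%:C%C *: Q) = r * bform lam P Q.
Proof. by rewrite bformC bformZl bformC. Qed.

Lemma bform_sumr I (r : seq I) (p : pred I) P (F : I -> M) :
  bform lam P (\sum_(i <- r | p i) F i) = \sum_(i <- r | p i) bform lam P (F i).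
Proof.
apply: (big_morph (bform lam P)) => [Q Q'|]; first exact: bformDr.
by have := bformZr 0 P 0; rewrite mul0r scaler0.
Qed.

Lemma bform_suml I (r : seq I) (p : pred I) Q (F : I -> M) :
  bform lam (\sum_(i <- r | p i) F i) Q = \sum_(i <- r | p i) bform lam (F i) Q.
Proof. by rewrite bformC bform_sumr; apply: eq_bigr => i _; rewrite bformC. Qed.

Lemma bformNr P Q : bform lam P (- Q) = - bform lam P Q.
Proof.
have := bformZr (-1) P Q; rewrite mulN1r => <-; congr bform.
by rewrite rmorphN rmorph1 scaleN1r.
Qed.

(** Invariance of the metric under the torus, in infinitesimal form. *)
Lemma bform_diag_inv (Y h Q : M) : (forall a b, a != b -> h a b = 0) ->
  bform lam Y (h *m Q - Q *m h) = bform lam (Y *m h - h *m Y) Q.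
Proof.
move=> hd.
have hl (A : M) a b : (h *m A) a b = h a a * A a b.
  by rewrite mxE (bigD1 a) //= big1 ?addr0 // => c ca; rewrite hd ?mul0r // eq_sym.
have hr (A : M) a b : (A *m h) a b = A a b * h b b.
  by rewrite mxE (bigD1 b) //= big1 ?addr0 // => c ca; rewrite hd ?mulr0.
have mxEB (A B : M) a b : (A - B) a b = A a b - B a b by rewrite !mxE.
rewrite !bform_real; congr (- _ *+ _ *+ _).
apply: eq_bigr => a _; apply: eq_bigr => b _; congr (_ * complex.Re _).
by rewrite !mxEB hl hr hl hr; ring.
Qed.

Lemma bform_definite P : skewhermitian P -> bform lam P P = 0 -> m_proj P = 0.
Proof.
move=> sP; rewrite bform_real mulNrn mulNrn => /eqP; rewrite oppr_eq0 => /eqP H.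
have pab a b : P b a = - Num.conj (P a b).
  by have /matrixP/(_ b a) := sP; rewrite adjmxE mxE => ->; rewrite opprK.
have reE a b : complex.Re (P a b * P b a) =
    - (complex.Re (P a b) ^+ 2 + complex.Im (P a b) ^+ 2).
  by rewrite (pab a b) mulrN ReN ReM Re_conj Im_conj; ring.
have mu0 a b : 0 <= mu a b.
  by rewrite /offdiag_coef; case: eqVneq => // ab; apply/ltW; case: lamP => _; apply.
apply/matrixP => a b; rewrite !mxE; case: eqVneq => // ab.
have n0 : (0 < n)%N := leq_ltn_trans (leq0n a) (ltn_ord a).
move: H => /eqP; rewrite -mulrnA mulrn_eq0 muln_eq0 orbF (gtn_eqF n0) /= => /eqP H.
have H' : \sum_a \sum_b mu a b * (complex.Re (P a b) ^+ 2 + complex.Im (P a b) ^+ 2) = 0.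
  apply/eqP; rewrite -oppr_eq0 -sumrN; apply/eqP; rewrite -[RHS]H; apply: eq_bigr => i _.
  by rewrite -sumrN; apply: eq_bigr => j _; rewrite reE mulrN.
have t0 i j : 0 <= mu i j * (complex.Re (P i j) ^+ 2 + complex.Im (P i j) ^+ 2).
  by rewrite mulr_ge0 // addr_ge0 // sqr_ge0.
have := H'; move=> /eqP; rewrite psumr_eq0; last by move=> i _; apply: sumr_ge0.
move=> /allP /(_ a (mem_index_enum _)) /=; rewrite psumr_eq0 //.
move=> /allP /(_ b (mem_index_enum _)) /=; rewrite mulf_eq0 /offdiag_coef (negbTE ab).
rewrite gt_eqF /=; last by case: lamP => _; apply.
rewrite paddr_eq0 ?sqr_ge0 // !sqrf_eq0 => /andP[/eqP h1 /eqP h2].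
exact: complex_eq.
Qed.

Lemma is_derive_bform (V : normedModType R) (x v : V) (F G : V -> M) D E :
  is_mxderive x v F D -> is_mxderive x v G E ->
  is_derive x v (fun z => bform lam (F z) (G z)) (bform lam D (G x) + bform lam (F x) E).
Proof.
move=> h1 h2.
have hS : is_cderive x v (fun z => \sum_a \sum_b (mu a b)%:C%C * (F z a b * G z b a))
   (\sum_a \sum_b (mu a b)%:C%C * (D a b * G x b a + F x a b * E b a)).
  apply: is_cderive_sum => a _; apply: is_cderive_sum => b _.
  apply: is_cderive_eq (is_cderiveM (is_cderive_cst x v _) (is_cderiveM (h1 a b) (h2 b a))) _.
  by rewrite mul0r add0r.
have [hr _] := hS.
have hk : is_derive x v (fun z => bform lam (F z) (G z))
  (- (complex.Re (\sum_a \sum_b (mu a b)%:C%C * (D a b * G x b a + F x a b * E b a)) *+ n *+ 2)).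
  have := is_deriveN (is_deriveZ (n * 2)%:R hr).
  rewrite (_ : - (_ \*: _) = (fun z => bform lam (F z) (G z))).
    by rewrite /GRing.scale /= mulr_natl mulrnA.
  by apply/funext => z; rewrite /bform /GRing.opp /= /GRing.scale /= mulr_natl mulrnA.
apply: is_derive_eq hk _; rewrite /bform -opprD -!mulrnDl -ReD; congr (- (complex.Re _ *+ _ *+ _)).
rewrite -big_split; apply: eq_bigr => a _; rewrite -big_split; apply: eq_bigr => b _ /=.
by rewrite mulrDr.
Qed.

End BilinearForm.
End KillingForm.

(** * The geodesic equation, lowered *)

(** At a fixed point of a fixed path: [theta i] stands for the Maurer-Cartan form on the i-th
    coordinate vector, [T k i] for its derivative along the k-th one, [u] and [w] for the
    first and second derivatives of the path. Then [D k i j] is the derivative of g_ij along the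
    k-th coordinate, and [Omega'] is the derivative of [Omega] along the path. *)
Section LoweredGeodesicEquation.
Variables (R : realType) (n d : nat).
Local Notation C := R[i].
Local Notation M := 'M[C]_n.
Variable lam : 'I_n -> 'I_n -> R.
Hypothesis lamP : metric_coefs lam.
Local Notation B := (bform lam).

Variables (theta : 'I_d -> M) (T : 'I_d -> 'I_d -> M) (u w : 'I_d -> R) (g : 'M[R]_d).
Hypothesis gE : forall i j, g i j = B (theta i) (theta j).
Hypothesis maurer_cartan :
  forall i l, T i l - T l i = - (theta i *m theta l - theta l *m theta i).

Let D i j l := B (T i j) (theta l) + B (theta j) (T i l).
Let Omega := \sum_i (u i)%:C%C *: theta i.
Let Omega' := \sum_j (w j)%:C%C *: theta j + \sum_i \sum_j (u i * u j)%:C%C *: T i j.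

Lemma sum_sym (f : 'I_d -> 'I_d -> R) :
  \sum_i \sum_j f i j = \sum_i \sum_j 2^-1 * (f i j + f j i).
Proof.
have E : \sum_i \sum_j f i j = \sum_i \sum_j f j i by rewrite exchange_big.
have -> : \sum_i \sum_j 2^-1 * (f i j + f j i) =
    2^-1 * (\sum_i \sum_j f i j + \sum_i \sum_j f j i).
  rewrite -big_split mulr_sumr; apply: eq_bigr => i _.
  by rewrite -big_split mulr_sumr.
by rewrite -E; field.
Qed.

(** After symmetrizing in [i] and [j], the derivatives of the metric enter only through
    [T i j] and [T l i - T i l]; the latter is a bracket by [maurer_cartan]. *)
Lemma lowered_christoffel l :
  \sum_i \sum_j 2^-1 * (D i j l + D j i l - D l i j) * u i * u j =
  B (theta l) (\sum_i \sum_j (u i * u j)%:C%C *: T i j) -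
  B Omega (Omega *m theta l - theta l *m Omega).
Proof.
have -> : Omega *m theta l - theta l *m Omega =
    \sum_i (u i)%:C%C *: (T l i - T i l).
  rewrite /Omega mulmx_suml mulmx_sumr -sumrB; apply: eq_bigr => i _.
  rewrite -scalemxAl -scalemxAr -scalerBr; congr (_ *: _).
  by rewrite -[RHS]opprB maurer_cartan opprK.
have -> : B Omega (\sum_i (u i)%:C%C *: (T l i - T i l)) =
    \sum_i \sum_j u i * u j * B (theta j) (T l i - T i l).
  rewrite (bform_sumr lamP); apply: eq_bigr => i _.
  rewrite (bformZr lamP) /Omega (bform_suml lamP) mulr_sumr; apply: eq_bigr => j _.
  by rewrite bformZl mulrA.
have -> : B (theta l) (\sum_i \sum_j (u i * u j)%:C%C *: T i j) =
    \sum_i \sum_j u i * u j * B (theta l) (T i j).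
  rewrite (bform_sumr lamP); apply: eq_bigr => i _.
  rewrite (bform_sumr lamP); apply: eq_bigr => j _.
  by rewrite (bformZr lamP).
transitivity (\sum_i \sum_j u i * u j * (B (theta l) (T i j) - B (theta j) (T l i - T i l))).
  rewrite [RHS]sum_sym; apply: eq_bigr => i _; apply: eq_bigr => j _.
  rewrite /D !(bformDr lamP) !(bformNr lamP).
  rewrite (bformC lamP (T i j)) (bformC lamP (T j i)) (bformC lamP (T l i)); ring.
rewrite -sumrB; apply: eq_bigr => i _; rewrite -sumrB; apply: eq_bigr => j _.
by rewrite mulrBr.
Qed.

(** Multiplication by the invertible matrix [g] passes from the geodesic equation to its lowered
    form and back. *)
Lemma lowered_geodesic : g \in unitmx ->
  (forall k, w k + \sum_i \sum_j
     (2^-1 * \sum_l invmx g k l * (D i j l + D j i l - D l i j)) * u i * u j = 0) <->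
  (forall l, B (theta l) Omega' - B Omega (Omega *m theta l - theta l *m Omega) = 0).
Proof.
move=> gU.
pose a l := \sum_i \sum_j 2^-1 * (D i j l + D j i l - D l i j) * u i * u j.
pose av : 'cV[R]_d := \col_l a l.
pose wv : 'cV[R]_d := \col_l w l.
have G k : w k + \sum_i \sum_j
     (2^-1 * \sum_l invmx g k l * (D i j l + D j i l - D l i j)) * u i * u j
   = (wv + invmx g *m av) k 0.
  rewrite !mxE; congr (_ + _).
  transitivity (\sum_l \sum_i \sum_j invmx g k l * (2^-1 * (D i j l + D j i l - D l i j) * u i * u j)).
    rewrite [RHS]exchange_big; apply: eq_bigr => i _; rewrite [RHS]exchange_big; apply: eq_bigr => j _ /=.
    rewrite mulr_sumr !mulr_suml; apply: eq_bigr => l _; ring.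
  apply: eq_bigr => l _; rewrite mxE /a mulr_sumr; apply: eq_bigr => i _.
  by rewrite mulr_sumr.
have E l : B (theta l) Omega' - B Omega (Omega *m theta l - theta l *m Omega)
   = (g *m wv + av) l 0.
  rewrite [RHS]mxE [av l 0]mxE /a lowered_christoffel addrA; congr (_ - _).
  rewrite (bformDr lamP); congr (_ + _).
  rewrite (bform_sumr lamP) mxE; apply: eq_bigr => j _.
  by rewrite (bformZr lamP) gE mxE mulrC.
split=> H.
  move=> l; rewrite E.
  have Z : wv + invmx g *m av = 0 by apply/colP => k; rewrite -G H mxE.
  by have := congr1 (mulmx g) Z; rewrite mulmxDr mulKVmx // mulmx0 => ->; rewrite mxE.
move=> k; rewrite G.
have Z : g *m wv + av = 0 by apply/colP => l; rewrite -E H mxE.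
by have := congr1 (mulmx (invmx g)) Z; rewrite mulmxDr mulKmx // mulmx0 => ->; rewrite mxE.
Qed.

End LoweredGeodesicEquation.

(** * The Maurer-Cartan form in local coordinates *)

Section LocalCoordinates.
Variables (R : realType) (n : nat).
Local Notation C := R[i].
Local Notation M := 'M[C]_n.
Local Notation d := (flag_dim n).
Local Notation E := 'rV[R]_d.
Local Notation e l := (delta_mx 0 l : E).

Lemma smooth_on_partial (U : set E) f (l : 'I_d) : smooth_on U f -> smooth_on U (partial l f).
Proof. by move=> H k; exact: (H k.+1).2. Qed.

Lemma smooth_mx_partial (U : set E) (s : E -> M) (l : 'I_d) :
  smooth_mx_on U s -> smooth_mx_on U (partial_mx l s).
Proof.
move=> H i j.
have -> : (fun x => complex.Re (partial_mx l s x i j)) = partial l (fun z => complex.Re (s z i j)).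
  by apply/funext => x; rewrite mxE.
have -> : (fun x => complex.Im (partial_mx l s x i j)) = partial l (fun z => complex.Im (s z i j)).
  by apply/funext => x; rewrite mxE.
by split; apply: smooth_on_partial; case: (H i j).
Qed.

Lemma is_mxderive_partial (U : set E) (s : E -> M) x l : smooth_mx_on U s -> U x ->
  is_mxderive x (e l) s (partial_mx l s x).
Proof.
move=> H Ux i j; have [hr hi] := H i j; rewrite mxE; split.
  exact: derivableP ((hr 1%N).1 x Ux l).
exact: derivableP ((hi 1%N).1 x Ux l).
Qed.

Lemma mx_chain (U : set E) (F : E -> M) (y : R -> E) t : open U -> U (y t) ->
  smooth_mx_on U F -> (forall i, derivable (fun s => y s 0 i) t 1) ->
  is_mxderive t 1 (fun tau => F (y tau))
    (\sum_i (derive1 (fun s => y s 0 i) t)%:C%C *: partial_mx i F (y t)).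
Proof.
move=> oU Uy HF dy a b; have [hr hi] := HF a b; rewrite summxE; split.
  apply: is_derive_eq (C1_chain oU Uy (hr 1%N) dy) _.
  by rewrite Re_sum; apply: eq_bigr => i _; rewrite mxE Re_rM mxE mulrC.
apply: is_derive_eq (C1_chain oU Uy (hi 1%N) dy) _.
by rewrite Im_sum; apply: eq_bigr => i _; rewrite mxE Im_rM mxE mulrC.
Qed.

Lemma schwarz_mx (U : set E) (s : E -> M) x k l : open U -> U x -> smooth_mx_on U s ->
  partial_mx k (partial_mx l s) x = partial_mx l (partial_mx k s) x.
Proof.
move=> oU Ux H; apply/matrixP => i j; have [hr hi] := H i j.
have rE m : (fun z => complex.Re (partial_mx m s z i j)) = partial m (fun z => complex.Re (s z i j)).
  by apply/funext => z; rewrite mxE.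
have iE m : (fun z => complex.Im (partial_mx m s z i j)) = partial m (fun z => complex.Im (s z i j)).
  by apply/funext => z; rewrite mxE.
rewrite [LHS]mxE [RHS]mxE (rE k) (rE l) (iE k) (iE l).
by rewrite (schwarz k l oU Ux (hr 2)) (schwarz k l oU Ux (hi 2)).
Qed.

Local Opaque partial_mx partial derive.

Variables (U : set E) (s : E -> M).
Hypothesis lc : local_coordinates U s.

(** The pull-back by [s] of the Maurer-Cartan form, evaluated on the l-th coordinate vector. *)
Definition mc_form (l : 'I_d) (x : E) : M := (s x)^t* *m partial_mx l s x.

(** The derivative of [mc_form l] along the k-th coordinate. *)
Definition mc_form_partial (k l : 'I_d) (x : E) : M :=
  (partial_mx k s x)^t* *m partial_mx l s x + (s x)^t* *m partial_mx k (partial_mx l s) x.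

Lemma is_mxderive_mc_form k l x : U x ->
  is_mxderive x (e k) (mc_form l) (mc_form_partial k l x).
Proof.
case: lc => oU _ H _ Ux; apply: is_mxderiveM.
  by apply: is_mxderive_adj; exact: is_mxderive_partial H Ux.
exact: is_mxderive_partial (smooth_mx_partial l H) Ux.
Qed.

Lemma lc_unitary x : U x -> (s x)^t* *m s x = 1%:M.
Proof. by case: lc => _ H _ _ /H [/unitarymxP sx _]; exact: mulmx1C. Qed.

Lemma lc_near x : U x -> \near x, U x.
Proof. by case: lc => oU _ _ _ Ux; exact: open_nbhs_nbhs. Qed.

(** Differentiate the constant product of the adjoint of [s] with [s]. *)
Lemma mc_form_adj l x : U x -> (partial_mx l s x)^t* *m s x = - mc_form l x.
Proof.
move=> Ux; have [oU _ H _] := lc; have h := is_mxderive_partial l H Ux.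
have h1 := is_mxderiveM (is_mxderive_adj h) h.
have h2 : is_mxderive x (e l) (fun z => (s z)^t* *m s z) 0.
  apply: is_mxderive_near (is_mxderive_cst x (e l) 1%:M).
  by apply: filterS (lc_near Ux) => z /lc_unitary ->.
by have /eqP := is_mxderive_unique h1 h2; rewrite addr_eq0 => /eqP.
Qed.

Lemma trmxC_mul m p q (A : 'M[C]_(m, p)) (B : 'M[C]_(p, q)) :
  (A *m B)^t* = B^t* *m A^t*.
Proof. by rewrite trmx_mul map_mxM. Qed.

Lemma mc_form_skew l x : U x -> skewhermitian (mc_form l x).
Proof. by move=> Ux; rewrite /skewhermitian -mc_form_adj // trmxC_mul trmxCK. Qed.

(** The second derivatives of [s] cancel by symmetry, and [s] is unitary, so that the products of
    first derivatives are products of values of the form. *)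
Lemma maurer_cartan_eq i l x : U x ->
  mc_form_partial i l x - mc_form_partial l i x =
  - (mc_form i x *m mc_form l x - mc_form l x *m mc_form i x).
Proof.
move=> Ux; have [oU _ H _] := lc.
have uc : s x *m (s x)^t* = 1%:M by apply: mulmx1C; exact: lc_unitary.
have EE k m : (partial_mx k s x)^t* *m partial_mx m s x = - (mc_form k x *m mc_form m x).
  rewrite -mulNmx -(mc_form_adj k Ux) /mc_form.
  by rewrite -mulmxA (mulmxA (s x)) uc mul1mx.
have alg (p q r : M) : - p + r - (- q + r) = - (p - q).
  by rewrite opprD addrACA subrr addr0 opprB opprK addrC.
by rewrite /mc_form_partial (schwarz_mx l i oU Ux H) (EE i l) (EE l i); exact: alg.
Qed.

Variable lam : 'I_n -> 'I_n -> R.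
Hypothesis lamP : metric_coefs lam.

Lemma metric_matrixE x i j : metric_matrix lam s x i j = bform lam (mc_form i x) (mc_form j x).
Proof. by rewrite mxE inv_metricE. Qed.

Lemma partial_metric k i j x : U x ->
  partial k (fun z => metric_matrix lam s z i j) x =
  bform lam (mc_form_partial k i x) (mc_form j x) +
  bform lam (mc_form i x) (mc_form_partial k j x).
Proof.
move=> Ux.
have -> : (fun z => metric_matrix lam s z i j) = (fun z => bform lam (mc_form i z) (mc_form j z)).
  by apply/funext => z; rewrite metric_matrixE.
have h := is_derive_bform lam (is_mxderive_mc_form k i Ux) (is_mxderive_mc_form k j Ux).
exact: (@derive_val _ _ _ _ _ _ _ h).
Qed.

(** A vector in the kernel has zero length, hence projects to zero in m, hence is zero because
    the coordinates are immersive. *)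
Lemma metric_unit x : U x -> metric_matrix lam s x \in unitmx.
Proof.
move=> Ux; have [_ _ _ inj] := lc.
rewrite -row_free_unit; apply: inj_row_free => v v0.
apply: (inj x Ux); rewrite /to_origin.
have EV : (s x)^t* *m (\sum_(l < d) (v 0 l)%:C%C *: partial_mx l s x) =
    \sum_(l < d) (v 0 l)%:C%C *: mc_form l x.
  by rewrite mulmx_sumr; apply: eq_bigr => l _; rewrite -scalemxAr.
rewrite EV; apply: (bform_definite lamP).
  apply/matrixP => a b; rewrite adjmxE mxE !summxE rmorph_sum -sumrN.
  apply: eq_bigr => l _; rewrite mxE [X in - X]mxE.
  have /matrixP/(_ a b) := mc_form_skew l Ux; rewrite adjmxE [RHS]mxE => hab.
  by apply: complex_eq; rewrite ?Re_conj ?Im_conj ?ReN ?ImN ?Re_rM ?Im_rM;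
     have := congr1 (@complex.Re R) hab; have := congr1 (@complex.Im R) hab;
     rewrite ?Re_conj ?Im_conj ?ReN ?ImN => h1 h2; rewrite -?mulrN ?h1 ?h2.
rewrite (bform_suml lamP) big1 // => l _; rewrite bformZl (bform_sumr lamP).
have /rowP/(_ l) := v0; rewrite !mxE => H.
rewrite (_ : \sum_i _ = 0) ?mulr0 // -[RHS]H; apply: eq_bigr => i _.
by rewrite (bformZr lamP) (metric_matrixE x i l) (bformC lamP (mc_form l x)).
Qed.

End LocalCoordinates.

(** * Orbit curves in local coordinates *)

(** A path [y] in local coordinates that represents the orbit curve of [X]: it lifts to
    [sigma = W kappa] with [W] the one-parameter group of [X] and [kappa] in the torus. The velocity
    of the lift is [Omega], and [Y] is [X] moved to the point [sigma t]. *)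
Section Path.
Local Opaque partial_mx partial derive mc_form mc_form_partial.
Variables (R : realType) (n : nat).
Local Notation C := R[i].
Local Notation M := 'M[C]_n.
Local Notation d := (flag_dim n).
Local Notation E := 'rV[R]_d.

Lemma torus1 : torus (1%:M : M).
Proof.
split; last by rewrite scalar_mx_is_diag.
by split; [apply/unitarymxP; rewrite trmx1 map_mx1 mulmx1|rewrite det1].
Qed.

Lemma coset_self (g : M) : coset g g.
Proof. by exists 1%:M; [exact: torus1|rewrite mulmx1]. Qed.

Variables (X : M) (mX : m_space X).

Let sX : skewhermitian X. Proof. by case: mX. Qed.
Let trX : \tr X = 0. Proof. by rewrite /mxtrace big1 //; case: mX. Qed.

Lemma expmx_unitary t : expmx (t%:C%C *: X) *m (expmx (t%:C%C *: X))^t* = 1%:M.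
Proof. by have [/unitarymxP] := SU_expmx sX t trX. Qed.

Variables (lam : 'I_n -> 'I_n -> R) (lamP : metric_coefs lam).
Variables (U : set E) (s : E -> M) (lc : local_coordinates U s).
Variables (J : set R) (y : R -> E) (oJ : open J).
Hypothesis ysmooth : forall l, smooth_path_on J (fun t => y t 0 l).
Hypothesis ycurve : forall t, J t -> U (y t) /\ orbit_curve X t = coset (s (y t)).

Let u i (t : R) : R := derive1 (fun s => y s 0 i) t.
Let sigma t := s (y t).
Let sigma' t := \sum_i (u i t)%:C%C *: partial_mx i s (y t).
Let Omega t := \sum_i (u i t)%:C%C *: mc_form s i (y t).
Let Y t := (sigma t)^t* *m X *m sigma t.
Let W (t : R) := expmx (t%:C%C *: X).
Let kappa t := (W t)^t* *m sigma t.
Let kappa' t := (X *m W t)^t* *m sigma t + (W t)^t* *m sigma' t.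

Lemma near_J t : J t -> \near t, J t.
Proof. by move=> Jt; exact: open_nbhs_nbhs. Qed.

Lemma is_mxderive_lift t : J t -> is_mxderive t 1 sigma (sigma' t).
Proof.
move=> Jt; have [oU _ H _] := lc; have [Uy _] := ycurve Jt.
have dy i : derivable (fun s => y s 0 i) t 1 by exact: (@ysmooth i 0%N t Jt).
exact: (mx_chain oU Uy H dy).
Qed.

Lemma velocityE t : J t -> Omega t = (sigma t)^t* *m sigma' t.
Proof.
move=> Jt; rewrite mulmx_sumr; apply: eq_bigr => i _.
by rewrite -scalemxAr.
Qed.

Lemma kappa_diag t a b : J t -> a != b -> kappa t a b = 0.
Proof.
move=> Jt ab; have [_ cE] := ycurve Jt.
have : coset (s (y t)) (sigma t) by exact: coset_self.
rewrite -cE => -[k [_ /is_diag_mxP kd] kE].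
have -> : kappa t = k.
  have uc : (W t)^t* *m W t = 1%:M by apply: mulmx1C; exact: expmx_unitary.
  by rewrite /kappa -kE mulmxA uc mul1mx.
exact: kd.
Qed.

Lemma is_mxderive_kappa t : J t -> is_mxderive t 1 kappa (kappa' t).
Proof.
move=> Jt; apply: is_mxderiveM; last exact: is_mxderive_lift.
by apply: is_mxderive_adj; exact: is_mxderive_expmx.
Qed.

Lemma kappa'_diag t a b : J t -> a != b -> kappa' t a b = 0.
Proof.
move=> Jt ab; apply: is_cderive_unique (is_mxderive_kappa Jt a b) _.
apply: is_cderive_near (is_cderive_cst t 1 0).
by apply: filterS (near_J Jt) => z Jz; rewrite kappa_diag.
Qed.

Lemma kappaK t : W t *m kappa t = sigma t.
Proof. by rewrite /kappa mulmxA expmx_unitary mul1mx. Qed.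

(** From [sigma = W kappa] and [W' = X W], the logarithmic derivative of [sigma] is that of [kappa]
    plus the conjugate of [X]. *)
Lemma velocity_split t : J t -> Omega t - Y t = (kappa t)^t* *m kappa' t.
Proof.
move=> Jt; rewrite velocityE // /kappa' mulmxDr addrC.
have kW : (kappa t)^t* *m (W t)^t* = (sigma t)^t* by rewrite -trmxC_mul kappaK.
rewrite trmxC_mul sX mulmxN mulNmx mulmxN -mulmxA !mulmxA kW.
by congr (_ + _); rewrite /Y.
Qed.

(** The difference is the logarithmic derivative of [kappa], which is diagonal. *)
Lemma velocity_offdiag t a b : J t -> a != b -> Omega t a b = Y t a b.
Proof.
move=> Jt ab; apply/eqP; rewrite -subr_eq0.
have := velocity_split Jt => /matrixP /(_ a b); rewrite mxE [X in _ + X]mxE => ->.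
rewrite mxE big1 // => c _; case: (eqVneq c b) => [->|cb].
  by rewrite adjmxE kappa_diag ?conjC0 ?mul0r // eq_sym.
by rewrite kappa'_diag ?mulr0.
Qed.

Lemma velocity_skew t : J t -> skewhermitian (Omega t).
Proof.
move=> Jt; have [Uy _] := ycurve Jt.
apply/matrixP => a b; rewrite adjmxE mxE !summxE rmorph_sum -sumrN.
apply: eq_bigr => l _; rewrite mxE [X in - X]mxE.
have /matrixP/(_ a b) := mc_form_skew lc l Uy; rewrite adjmxE [RHS]mxE => hab.
rewrite rmorphM /= hab mulrN; congr (- (_ * _)).
by apply: complex_eq; rewrite ?Re_conj ?Im_conj /= ?oppr0.
Qed.

Lemma lift'E t : J t -> sigma' t = sigma t *m Omega t.
Proof.
move=> Jt; have [Uy _] := ycurve Jt; rewrite velocityE // mulmxA.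
by rewrite (mulmx1C (lc_unitary lc Uy)) mul1mx.
Qed.

(** [Y] is conjugated by [sigma], whose velocity is the skew-Hermitian [Omega]. *)
Lemma is_mxderive_Y t : J t -> is_mxderive t 1 Y (Y t *m Omega t - Omega t *m Y t).
Proof.
move=> Jt; have h := is_mxderive_lift Jt.
have h1 := is_mxderiveM (is_mxderiveM (is_mxderive_adj h) (is_mxderive_cst t 1 X)) h.
move: h1; rewrite mulmx0 addr0; congr is_mxderive.
rewrite lift'E // trmxC_mul velocity_skew // !mulNmx addrC /Y !mulmxA.
by congr (_ - _); rewrite !mulmxA.
Qed.

Let w i (t : R) : R := derive1n 2 (fun s => y s 0 i) t.

Lemma is_derive_velocity i t : J t -> is_derive t 1 (u i) (w i t).
Proof.
move=> Jt; have h := @ysmooth i 1%N t Jt.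
rewrite derive1n1 in h; rewrite /w derive1nS derive1n1 derive1E.
exact: derivableP h.
Qed.

Lemma is_mxderive_Omega t : J t -> is_mxderive t 1 Omega
  (\sum_j (w j t)%:C%C *: mc_form s j (y t) +
   \sum_i \sum_j (u i t * u j t)%:C%C *: mc_form_partial s i j (y t)).
Proof.
move=> Jt; have [oU _ H _] := lc; have [Uy _] := ycurve Jt.
have dy i : derivable (fun s => y s 0 i) t 1 by exact: (@ysmooth i 0%N t Jt).
have hm j : is_mxderive t 1 (fun tau => mc_form s j (y tau))
    (\sum_i (u i t)%:C%C *: mc_form_partial s i j (y t)).
  have h1 := is_mxderiveM (is_mxderive_adj (is_mxderive_lift Jt))
     (mx_chain oU Uy (smooth_mx_partial j H) dy).
  have -> : \sum_i (u i t)%:C%C *: mc_form_partial s i j (y t) =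
     (sigma' t)^t* *m partial_mx j s (y t) + (sigma t)^t* *m
      \sum_i (u i t)%:C%C *: partial_mx i (partial_mx j s) (y t).
    have -> : (sigma' t)^t* = \sum_i (u i t)%:C%C *: (partial_mx i s (y t))^t*.
      apply/matrixP => a b; rewrite adjmxE !summxE rmorph_sum; apply: eq_bigr => i _.
      rewrite mxE [RHS]mxE adjmxE rmorphM; congr (_ * _).
      by apply: complex_eq; rewrite ?Re_conj ?Im_conj /= ?oppr0.
    rewrite mulmx_suml mulmx_sumr -big_split; apply: eq_bigr => i _ /=.
    by rewrite -scalemxAl -scalemxAr -scalerDr.
  exact: h1.
have h : is_mxderive t 1 Omega (\sum_j ((w j t)%:C%C *: mc_form s j (y t) +
    (u j t)%:C%C *: \sum_i (u i t)%:C%C *: mc_form_partial s i j (y t))).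
  by apply: is_mxderive_sum => j _; exact: is_mxderiveZ (is_derive_velocity j Jt) (hm j).
move: h; congr is_mxderive; rewrite big_split; congr (_ + _).
rewrite exchange_big; apply: eq_bigr => j _; rewrite scaler_sumr; apply: eq_bigr => i _.
by rewrite scalerA rmorphM mulrC.
Qed.

(** The diagonal part [h] of [Omega] contributes B(theta_l, [Y, h]) on one side and
    B(Y, [h, theta_l]) on the other, and these cancel by [bform_diag_inv]. *)
Lemma geodesic_equationP t : J t ->
  geodesic_equation (metric_matrix lam s) y t <->
  (forall l, bform lam (Y t) (Y t *m mc_form s l (y t) - mc_form s l (y t) *m Y t) = 0).
Proof.
move=> Jt; have [Uy _] := ycurve Jt.
pose theta i := mc_form s i (y t).
have L := lowered_geodesic lamP (theta := theta) (T := fun i j => mc_form_partial s i j (y t))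
   (fun i => u i t) (fun i => w i t) (fun i j => metric_matrixE s lam (y t) i j)
   (fun i l => maurer_cartan_eq lc i l Uy) (metric_unit lc lamP Uy).
pose D i j l := bform lam (mc_form_partial s i j (y t)) (theta l) +
  bform lam (theta j) (mc_form_partial s i l (y t)).
have G : geodesic_equation (metric_matrix lam s) y t <-> forall k : 'I_d,
  w k t + \sum_(i < d) \sum_(j < d)
    (2^-1 * \sum_(l < d) invmx (metric_matrix lam s (y t)) k l *
       (D i j l + D j i l - D l i j)) * u i t * u j t = 0.
  have E k : \sum_(i < d) \sum_(j < d) christoffel (metric_matrix lam s) (y t) k i j *
        derive1 (fun s => y s 0 i) t * derive1 (fun s => y s 0 j) t =
      \sum_(i < d) \sum_(j < d)
        (2^-1 * \sum_(l < d) invmx (metric_matrix lam s (y t)) k l *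
           (D i j l + D j i l - D l i j)) * u i t * u j t.
    apply: eq_bigr => i _; apply: eq_bigr => j _; congr (_ * _ * _); congr (_ * _).
    apply: eq_bigr => l _; congr (_ * (_ + _ - _)); exact: (partial_metric lc lam _ _ _ Uy).
  by split => H k; have := H k; rewrite -/(w k t) E.
have step l : bform lam (theta l) (\sum_j (w j t)%:C%C *: mc_form s j (y t) +
   \sum_i \sum_j (u i t * u j t)%:C%C *: mc_form_partial s i j (y t)) -
   bform lam (Omega t) (Omega t *m theta l - theta l *m Omega t) =
   - bform lam (Y t) (Y t *m theta l - theta l *m Y t).
  have [h OE] : exists h : M, Omega t = Y t + h.
    by exists (Omega t - Y t); rewrite addrC subrK.
  have hd a b : a != b -> h a b = 0.
    move=> ab; have h1 : Omega t a b = (Y t + h) a b by rewrite OE.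
    rewrite (velocity_offdiag Jt ab) [RHS]mxE in h1.
    by apply: (addrI (Y t a b)); rewrite addr0 -h1.
  (* off the diagonal Omega and Y agree near t, hence so do their derivatives there *)
  have dE a b : a != b -> (\sum_j (w j t)%:C%C *: mc_form s j (y t) +
     \sum_i \sum_j (u i t * u j t)%:C%C *: mc_form_partial s i j (y t)) a b =
     (Y t *m h - h *m Y t) a b.
    move=> ab; have hY := is_mxderive_Y Jt; have hO := is_mxderive_Omega Jt.
    have -> : Y t *m h - h *m Y t = Y t *m Omega t - Omega t *m Y t.
      by rewrite OE mulmxDr mulmxDl opprD addrACA subrr add0r.
    apply: is_cderive_unique (hO a b) _; apply: is_cderive_near (hY a b).
    by apply: filterS (near_J Jt) => z Jz; rewrite velocity_offdiag.
  rewrite (bform_eqr _ _ dE).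
  rewrite (bform_eql lamP (Omega t *m theta l - theta l *m Omega t)
    (fun a b ab => velocity_offdiag Jt ab)).
  have -> : Omega t *m theta l - theta l *m Omega t =
      (Y t *m theta l - theta l *m Y t) + (h *m theta l - theta l *m h).
    by rewrite OE mulmxDl mulmxDr opprD addrACA.
  rewrite (bformDr lamP (Y t)) (bform_diag_inv lam (Y t) (theta l) hd) (bformC lamP (theta l)).
  by rewrite opprD addrC subrK.
apply: iff_trans G _; apply: iff_trans L _.
split => H l; have := H l; rewrite step => /eqP.
  by rewrite oppr_eq0 => /eqP.
by move=> /eqP hl; rewrite hl oppr0.
Qed.

End Path.

(** * Trigonometric polynomials *)

Section TrigPolynomials.
Variable R : realType.
Local Notation C := R[i].

Section OneSpace.
Variable V : normedModType R.
Implicit Types (l : V -> R) (f g : V -> R).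

Definition linear_form l : Prop :=
  (forall x (h : R) v, l (x + h *: v) = l x + h * l v) /\ continuous l.

Lemma linear_form0 l : linear_form l -> l 0 = 0.
Proof. by move=> [ll _]; have := ll 0 (-1) 0; rewrite scaler0 addr0 mulN1r subrr. Qed.

Lemma linear_formD l1 l2 : linear_form l1 -> linear_form l2 ->
  linear_form (fun x => l1 x + l2 x).
Proof.
move=> [h1 c1] [h2 c2]; split=> [x h v|x]; first by rewrite h1 h2; ring.
by apply: cvgD; [exact: c1|exact: c2].
Qed.

Lemma linear_formM (c : R) l : linear_form l -> linear_form (fun x => l x * c).
Proof.
move=> [h1 c1]; split=> [x h v|x]; first by rewrite h1; ring.
by apply: cvgM; [exact: c1|exact: cvg_cst].
Qed.

Lemma is_derive_of_line f x v d :
  is_derive (0 : R) (1 : R) (fun h : R => f (x + h *: v)) d -> is_derive x v f d.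
Proof.
have E : (fun h : R => h^-1 *: (((fun h : R => f (x + h *: v)) \o shift 0) (h *: (1 : R))
             - f (x + (0 : R) *: v))) = (fun h : R => h^-1 *: ((f \o shift x) (h *: v) - f x)).
  apply/funext => h /=; rewrite addr0 scale0r addr0 [_%:A]mulr1.
  by rewrite [x + _]addrC.
by move=> [h1 h2]; apply: DeriveDef; [move: h1|move: h2]; rewrite /derivable /derive E.
Qed.

Lemma is_derive_comp_linear (F : R -> R) l x v d : linear_form l ->
  is_derive (l x) 1 F d -> is_derive x v (fun z => F (l z)) (l v * d).
Proof.
move=> [ll _] dF; apply: is_derive_of_line.
have -> : (fun h : R => F (l (x + h *: v))) = F \o (fun h => l x + h * l v).
  by apply/funext => h /=; rewrite ll.
have dl : is_derive (0 : R) 1 (fun h => l x + h * l v) (l v).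
  have -> : (fun h => l x + h * l v) = cst (l x) + l v \*: id.
    by apply/funext => h; rewrite [RHS]/= /cst mulrC.
  by apply: is_derive_eq; rewrite add0r [_ *: _]mulr1.
rewrite mulrC; apply: (@is_derive1_comp _ F (fun h => l x + h * l v)) dl.
by rewrite mul0r addr0.
Qed.

(** A class of functions that is visibly closed under partial derivatives, so that smoothness of
    every order follows by induction; it contains all entries of the matrices below. *)
Inductive trig_poly : (V -> R) -> Prop :=
| trig_cst c : trig_poly (fun=> c)
| trig_lin l : linear_form l -> trig_poly l
| trig_cos l : linear_form l -> trig_poly (fun x => cos (l x))
| trig_sin l : linear_form l -> trig_poly (fun x => sin (l x))
| trig_add f g : trig_poly f -> trig_poly g -> trig_poly (fun x => f x + g x)
| trig_mul f g : trig_poly f -> trig_poly g -> trig_poly (fun x => f x * g x).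

Lemma trig_ext f g : trig_poly f -> f =1 g -> trig_poly g.
Proof. by move=> + /funext <-. Qed.

Lemma trig_opp f : trig_poly f -> trig_poly (fun x => - f x).
Proof. by move=> h; apply: trig_ext (trig_mul (trig_cst (-1)) h) _ => x; rewrite mulN1r. Qed.

Lemma trig_sum (I : Type) (r : seq I) (P : pred I) (F : I -> V -> R) :
  (forall i, trig_poly (F i)) -> trig_poly (fun x => \sum_(i <- r | P i) F i x).
Proof.
move=> h; elim: r => [|i r IH].
  by apply: trig_ext (trig_cst 0) _ => x; rewrite big_nil.
case Pi: (P i); last by apply: trig_ext IH _ => x; rewrite big_cons Pi.
by apply: trig_ext (trig_add (h i) IH) _ => x; rewrite big_cons Pi.
Qed.

Lemma trig_prod (I : Type) (r : seq I) (P : pred I) (F : I -> V -> R) :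
  (forall i, trig_poly (F i)) -> trig_poly (fun x => \prod_(i <- r | P i) F i x).
Proof.
move=> h; elim: r => [|i r IH].
  by apply: trig_ext (trig_cst 1) _ => x; rewrite big_nil.
case Pi: (P i); last by apply: trig_ext IH _ => x; rewrite big_cons Pi.
by apply: trig_ext (trig_mul (h i) IH) _ => x; rewrite big_cons Pi.
Qed.

Lemma trig_continuous f : trig_poly f -> continuous f.
Proof.
elim=> {f} [c|l [_ //]|l [_ cl]|l [_ cl]|f g _ cf _ cg|f g _ cf _ cg] x.
- exact: cvg_cst.
- by apply: continuous_comp; [exact: cl|exact: continuous_cos].
- by apply: continuous_comp; [exact: cl|exact: continuous_sin].
- by apply: cvgD; [exact: cf|exact: cg].
- by apply: cvgM; [exact: cf|exact: cg].
Qed.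

Lemma trig_derive f v : trig_poly f ->
  exists2 g, trig_poly g & forall x, is_derive x v f (g x).
Proof.
elim=> {f} [c|l hl|l hl|l hl|f g tf [f' tf' df] tg [g' tg' dg]|f g tf [f' tf' df] tg [g' tg' dg]].
- by exists (fun=> 0); [exact: trig_cst|move=> x; exact: is_derive_cst].
- exists (fun=> l v * 1); first exact: trig_cst.
  by move=> x; apply: (@is_derive_comp_linear id).
- exists (fun x => l v * - sin (l x)).
    by apply: (trig_mul (trig_cst _)); apply: trig_opp; exact: trig_sin.
  by move=> x; apply: is_derive_comp_linear => //; exact: is_derive_cos.
- exists (fun x => l v * cos (l x)).
    by apply: (trig_mul (trig_cst _)); exact: trig_cos.
  by move=> x; apply: is_derive_comp_linear => //; exact: is_derive_sin.
- by exists (fun x => f' x + g' x); [exact: trig_add|move=> x; exact: is_deriveD].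
- exists (fun x => f x * g' x + g x * f' x).
    by apply: trig_add; exact: trig_mul.
  by move=> x; exact: (is_deriveM (df x) (dg x)).
Qed.

Definition trig_mx m n (F : V -> 'M[C]_(m, n)) : Prop := forall i j,
  trig_poly (fun x => complex.Re (F x i j)) /\ trig_poly (fun x => complex.Im (F x i j)).

Lemma trig_mx_cst m n (A : 'M[C]_(m, n)) : trig_mx (fun=> A).
Proof. by move=> i j; split; exact: trig_cst. Qed.

Lemma trig_mx_mul m n p (F : V -> 'M[C]_(m, n)) (G : V -> 'M[C]_(n, p)) :
  trig_mx F -> trig_mx G -> trig_mx (fun x => F x *m G x).
Proof.
move=> hF hG i j; split.
  apply: (trig_ext (f := fun x => \sum_k (complex.Re (F x i k) * complex.Re (G x k j)
     + - (complex.Im (F x i k) * complex.Im (G x k j))))) => [|x].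
    apply: trig_sum => k; have [h1 h2] := hF i k; have [h3 h4] := hG k j.
    by apply: trig_add; [exact: trig_mul|apply: trig_opp; exact: trig_mul].
  by rewrite mxE Re_sum; apply: eq_bigr => k _; rewrite ReM.
apply: (trig_ext (f := fun x => \sum_k (complex.Re (F x i k) * complex.Im (G x k j)
     + (complex.Im (F x i k) * complex.Re (G x k j))))) => [|x].
  apply: trig_sum => k; have [h1 h2] := hF i k; have [h3 h4] := hG k j.
  by apply: trig_add; exact: trig_mul.
by rewrite mxE Im_sum; apply: eq_bigr => k _; rewrite ImM.
Qed.

Lemma trig_mx_adj m n (F : V -> 'M[C]_(m, n)) : trig_mx F -> trig_mx (fun x => (F x)^t*).
Proof.
move=> hF i j; have [h1 h2] := hF j i; split.
  by apply: trig_ext h1 _ => x; rewrite adjmxE Re_conj.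
by apply: trig_ext (trig_opp h2) _ => x; rewrite adjmxE Im_conj.
Qed.

(** By the spectral form, the entries are combinations of cos(l a_j) and sin(l a_j). *)
Lemma trig_mx_expmx n (A : 'M[C]_n) l : skewhermitian A -> linear_form l ->
  trig_mx (fun x => expmx ((l x)%:C%C *: A)).
Proof.
move=> sA hl; have [P [th [uP EA Eexp]]] := expmx_skewP sA.
have hlt j := linear_formM (th j) hl.
move=> a b; split.
  apply: (trig_ext (f := fun x => \sum_j (cos (l x * th j) * complex.Re (Num.conj (P j a) * P j b) +
      - (sin (l x * th j) * complex.Im (Num.conj (P j a) * P j b))))) => [|x].
    apply: trig_sum => j; apply: trig_add; last apply: trig_opp.
      by apply: trig_mul (trig_cst _); exact: trig_cos (hlt j).
    by apply: trig_mul (trig_cst _); exact: trig_sin (hlt j).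
  by rewrite Eexp conj_diagE Re_sum; apply: eq_bigr => j _; rewrite [RHS]ReM.
apply: (trig_ext (f := fun x => \sum_j (cos (l x * th j) * complex.Im (Num.conj (P j a) * P j b) +
      (sin (l x * th j) * complex.Re (Num.conj (P j a) * P j b))))) => [|x].
  apply: trig_sum => j; apply: trig_add.
    by apply: trig_mul (trig_cst _); exact: trig_cos (hlt j).
  by apply: trig_mul (trig_cst _); exact: trig_sin (hlt j).
by rewrite Eexp conj_diagE Im_sum; apply: eq_bigr => j _; rewrite [RHS]ImM.
Qed.

Lemma trig_det d (F : V -> 'M[R]_d) : (forall i j, trig_poly (fun x => F x i j)) ->
  trig_poly (fun x => \det (F x)).
Proof.
move=> hF; apply: trig_sum => sg; apply: (trig_mul (trig_cst _)).
by apply: trig_prod => i; exact: hF.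
Qed.

Lemma is_mxderive_expmx_linear n (A : 'M[C]_n) l v : skewhermitian A -> linear_form l ->
  is_mxderive 0 v (fun x => expmx ((l x)%:C%C *: A)) ((l v)%:C%C *: A).
Proof.
move=> sA hl i j.
have := is_mxderive_expmx sA (l 0) i j.
rewrite (linear_form0 hl) (expmx0 sA) mulmx1 => -[h1 h2].
rewrite mxE; split; rewrite ?Re_rM ?Im_rM.
  apply: (@is_derive_comp_linear (fun t => complex.Re (expmx (t%:C%C *: A) i j))) => //.
  by rewrite (linear_form0 hl).
apply: (@is_derive_comp_linear (fun t => complex.Im (expmx (t%:C%C *: A) i j))) => //.
by rewrite (linear_form0 hl).
Qed.

End OneSpace.

Lemma trig_smooth_path (J : set R) (f : R -> R) : trig_poly f -> smooth_path_on J f.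
Proof.
move=> tf k t _.
have [g tg ->] : exists2 g, trig_poly g & derive1n k f = g.
  elim: k => [|k [g tg IH]]; first by exists f.
  have [g' tg' dg] := trig_derive (1 : R) tg; exists g' => //.
  rewrite derive1nS IH; apply/funext => z; rewrite derive1E.
  exact: (@derive_val _ _ _ _ _ _ _ (dg z)).
by have [g' _ dg] := trig_derive (1 : R) tg; case: (dg t).
Qed.

Lemma trig_smooth d (U : set 'rV[R]_d) f : trig_poly f -> smooth_on U f.
Proof.
move=> tf k; elim: k f tf => [|k IH] f tf; first by move=> x _; exact: trig_continuous.
split=> [x _ i|i]; first by have [g _ dg] := trig_derive (delta_mx 0 i : 'rV[R]_d) tf; case: (dg x).
have [g tg dg] := trig_derive (delta_mx 0 i : 'rV[R]_d) tf.
suff -> : partial i f = g by exact: IH.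
by apply/funext => x; exact: (@derive_val _ _ _ _ _ _ _ (dg x)).
Qed.

Lemma smooth_orbit_curve n (X : 'M[C]_n) : m_space X -> smooth_curve (orbit_curve X).
Proof.
move=> [sX X0]; exists (fun t => expmx (t%:C%C *: X)); split => //.
  by move=> t; apply: SU_expmx => //; rewrite /mxtrace big1.
move=> i j; have hl : linear_form (id : R -> R).
  split=> [x h v|x]; last exact: cvg_id.
  by [].
by have [h1 h2] := trig_mx_expmx sX hl i j; split; exact: trig_smooth_path.
Qed.

End TrigPolynomials.

(** * A chart adapted to an orbit curve *)

Section Chart.
Variables (R : realType) (n : nat).
Local Notation C := R[i].
Local Notation M := 'M[C]_n.
Local Notation d := (flag_dim n).
Local Notation E := 'rV[R]_d.
Local Notation e l := (delta_mx 0 l : E).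

(** One real coordinate for each ordered pair of distinct indices: [lift i] maps the remaining
    n - 1 indices bijectively onto those different from [i]. *)
Definition pair_coord (v : E) (i j : 'I_n) : R :=
  if unlift i j is Some k then (vec_mx v : 'M[R]_(n, n.-1)) i k else 0.

(** Taking c_ij - c_ji as real part and c_ij + c_ji as imaginary part gives a skew-Hermitian
    matrix without choosing an order on the pair, and c_ij is recovered as half the sum of
    both parts. *)
Definition m_of_coords (v : E) : M :=
  \matrix_(i, j) ((pair_coord v i j - pair_coord v j i) +i*
                  (pair_coord v i j + pair_coord v j i))%C.

Definition coords_of_m (P : M) : E :=
  mxvec (\matrix_(i < n, k < n.-1)
    (2^-1 * (complex.Re (P i (lift i k)) + complex.Im (P i (lift i k))))).

Lemma pair_coord_sum I (r : seq I) (c : I -> R) (v : I -> E) i j :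
  pair_coord (\sum_(l <- r) c l *: v l) i j = \sum_(l <- r) c l * pair_coord (v l) i j.
Proof.
rewrite /pair_coord; case: unlift => [k|]; last by rewrite big1 // => l _; rewrite mulr0.
by rewrite linear_sum summxE; apply: eq_bigr => l _; rewrite linearZ mxE.
Qed.

Lemma m_of_coords_sum (v : E) : m_of_coords v = \sum_l (v 0 l)%:C%C *: m_of_coords (e l).
Proof.
apply/matrixP => i j; rewrite {1}(row_sum_delta v) mxE !pair_coord_sum summxE.
apply: complex_eq.
  by rewrite Re_sum -sumrB; apply: eq_bigr => l _; rewrite mxE Re_rM mxE /= mulrBr.
by rewrite Im_sum -big_split; apply: eq_bigr => l _; rewrite mxE Im_rM mxE /= mulrDr.
Qed.

Lemma m_of_coords_skew v : skewhermitian (m_of_coords v).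
Proof.
apply/matrixP => i j; rewrite adjmxE !mxE; apply: complex_eq.
  by rewrite Re_conj ReN /= opprB.
by rewrite Im_conj ImN /= addrC.
Qed.

Lemma m_of_coords_diag v i : m_of_coords v i i = 0.
Proof. by rewrite mxE /pair_coord unlift_none subrr addr0. Qed.

Lemma m_of_coords_trace v : \tr (m_of_coords v) = 0.
Proof. by rewrite /mxtrace big1 // => i _; exact: m_of_coords_diag. Qed.

Lemma m_of_coordsK v : coords_of_m (m_of_coords v) = v.
Proof.
rewrite -[RHS]vec_mxK; congr mxvec; apply/matrixP => i k; rewrite !mxE /=.
have -> : pair_coord v i (lift i k) = v 0 (mxvec_index i k) by rewrite /pair_coord liftK mxE.
by field.
Qed.

Lemma coords_of_mK P : m_space P -> m_of_coords (coords_of_m P) = P.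
Proof.
move=> [sP P0]; apply/matrixP => i j; rewrite mxE.
have [->|ij] := eqVneq i j; first by rewrite P0 /pair_coord unlift_none subrr addr0.
have pc a b : a != b -> pair_coord (coords_of_m P) a b =
    2^-1 * (complex.Re (P a b) + complex.Im (P a b)).
  by move=> /unlift_some [k -> uk]; rewrite /pair_coord uk mxvecK mxE.
rewrite !pc // 1?eq_sym //.
have := sP => /matrixP/(_ j i); rewrite adjmxE mxE => Pji.
have h1 : complex.Re (P i j) = - complex.Re (P j i).
  by have := congr1 (@complex.Re R) Pji; rewrite Re_conj ReN.
have h2 : complex.Im (P i j) = complex.Im (P j i).
  by have := congr1 (@complex.Im R) Pji; rewrite Im_conj ImN => /oppr_inj.
by apply: complex_eq => /=; rewrite -?h2 ?h1; field.
Qed.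

Lemma coords_of_m_sum I (r : seq I) (c : I -> R) (P : I -> M) :
  coords_of_m (\sum_(l <- r) (c l)%:C%C *: P l) = \sum_(l <- r) c l *: coords_of_m (P l).
Proof.
apply/rowP => l; case/mxvec_indexP: l => i k.
rewrite mxvecE mxE summxE Re_sum Im_sum -big_split mulr_sumr summxE.
apply: eq_bigr => l _; rewrite [RHS]mxE mxvecE !mxE /= Re_rM Im_rM; ring.
Qed.

Lemma coords_of_m_proj P : coords_of_m (m_proj P) = coords_of_m P.
Proof.
apply/rowP => l; case/mxvec_indexP: l => i k; rewrite !mxvecE !mxE.
by rewrite (negbTE (neq_lift i k)).
Qed.

Lemma coords_of_m0 : coords_of_m 0 = 0.
Proof. by apply/rowP => l; case/mxvec_indexP: l => i k; rewrite mxvecE !mxE /= addr0 mulr0. Qed.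

Lemma linear_form_coord l : linear_form (fun x : E => x 0 l).
Proof.
split=> [x h v|]; first by rewrite !mxE.
exact: coord_continuous.
Qed.

Lemma big_mulmx_trig (V : normedModType R) (I : Type) (r : seq I) (F : I -> V -> M) :
  (forall l, trig_mx (F l)) -> trig_mx (fun x => \big[mulmx/1%:M]_(l <- r) F l x).
Proof.
move=> hF; elim: r => [|l r IH] i j.
  by have [h1 h2] := trig_mx_cst V (1%:M : M) i j; split;
    [apply: trig_ext h1 _|apply: trig_ext h2 _] => x; rewrite big_nil.
by have [h1 h2] := trig_mx_mul (hF l) IH i j; split;
  [apply: trig_ext h1 _|apply: trig_ext h2 _] => x; rewrite big_cons.
Qed.

Lemma SU_mul (g h : M) : SU g -> SU h -> SU (g *m h).
Proof.
move=> [ug dg] [uh dh]; split; first exact: mul_unitarymx.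
by rewrite det_mulmx dg dh mulr1.
Qed.

Lemma SU1 : SU (1%:M : M). Proof. by case: (@torus1 R n). Qed.

Lemma big_mulmx1 (I : Type) (r : seq I) : \big[mulmx/1%:M]_(l <- r) (1%:M : M) = 1%:M.
Proof. by elim: r => [|l r IH]; rewrite ?big_nil // big_cons IH mulmx1. Qed.

(** At a point where all the factors are the identity, the derivative of a product is the sum of
    the derivatives. *)
Lemma is_mxderive_big (V : normedModType R) (v : V) (I : eqType) (r : seq I) (F : I -> V -> M) (D : I -> M) :
  (forall l, F l 0 = 1%:M) -> (forall l, is_mxderive 0 v (F l) (D l)) ->
  is_mxderive 0 v (fun x => \big[mulmx/1%:M]_(l <- r) F l x) (\sum_(l <- r) D l).
Proof.
move=> F1 dF; elim: r => [|l r IH].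
  rewrite big_nil; apply: is_mxderive_ext (is_mxderive_cst 0 v 1%:M) => x.
  by rewrite big_nil.
rewrite big_cons; have h := is_mxderiveM (dF l) IH.
have : is_mxderive 0 v (fun z => F l z *m \big[mulmx/1%:M]_(k <- r) F k z) (D l + \sum_(j <- r) D j).
  move: h; congr is_mxderive; rewrite F1 mul1mx; congr (_ + _).
  by rewrite (eq_bigr (fun=> 1%:M)) // big_mulmx1 mulmx1.
by apply: is_mxderive_ext => x; rewrite big_cons.
Qed.

Lemma trig_mx_partial (F : E -> M) l : trig_mx F -> trig_mx (partial_mx l F).
Proof.
move=> hF i j; have [h1 h2] := hF i j; split.
  have [g tg dg] := trig_derive (e l) h1; apply: trig_ext tg _ => x.
  by rewrite mxE /=; apply/esym; exact: (@derive_val _ _ _ _ _ _ _ (dg x)).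
have [g tg dg] := trig_derive (e l) h2; apply: trig_ext tg _ => x.
by rewrite mxE /=; apply/esym; exact: (@derive_val _ _ _ _ _ _ _ (dg x)).
Qed.

Lemma trig_mx_smooth (F : E -> M) (U : set E) : trig_mx F -> smooth_mx_on U F.
Proof. by move=> hF i j; have [h1 h2] := hF i j; split; exact: trig_smooth. Qed.

Lemma trig_mc_form (F : E -> M) l : trig_mx F -> trig_mx (mc_form F l).
Proof.
by move=> hF; apply: trig_mx_mul; [exact: trig_mx_adj|exact: trig_mx_partial].
Qed.

(** The differential of [x] |-> [F x] K, as a square real matrix; [F] gives local coordinates
    where its determinant is not zero. *)
Definition mc_coords (F : E -> M) (x : E) : 'M[R]_d :=
  \matrix_l coords_of_m (mc_form F l x).

Lemma trig_mc_coords (F : E -> M) : trig_mx F ->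
  trig_poly (fun x => \det (mc_coords F x)).
Proof.
move=> hF; apply: trig_det => l m; case/mxvec_indexP: m => i k.
have [h1 h2] := trig_mc_form l hF i (lift i k).
apply: trig_ext (trig_mul (trig_cst _ 2^-1) (trig_add h1 h2)) _ => x.
by rewrite [RHS]mxE mxvecE [RHS]mxE.
Qed.

Definition regular_set (F : E -> M) : set E := [set x | \det (mc_coords F x) != 0].

Lemma open_regular_set (F : E -> M) : trig_mx F -> open (regular_set F).
Proof.
move=> hF; have /continuousP := trig_continuous (trig_mc_coords hF).
move=> /(_ [set r : R | r != 0]); apply.
have -> : [set r : R | r != 0] = ~` [set 0].
  by apply/seteqP; split => r /= /eqP.
by apply: closed_openC; exact: closed_eq.
Qed.

Lemma regular_local_coordinates (F : E -> M) : trig_mx F -> (forall x, SU (F x)) ->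
  local_coordinates (regular_set F) F.
Proof.
move=> hF suF; split; [exact: open_regular_set|by move=> x _|exact: trig_mx_smooth|].
move=> x Ux v v0.
have vN : v *m mc_coords F x = 0.
  have EV : (F x)^t* *m (\sum_(l < d) (v 0 l)%:C%C *: partial_mx l F x) =
      \sum_(l < d) (v 0 l)%:C%C *: mc_form F l x.
    by rewrite mulmx_sumr; apply: eq_bigr => l _; rewrite -scalemxAr.
  have := congr1 coords_of_m v0; rewrite coords_of_m0 /to_origin coords_of_m_proj EV.
  rewrite coords_of_m_sum => <-; apply/rowP => m; rewrite mxE summxE.
  by apply: eq_bigr => l _; rewrite [RHS]mxE [X in _ * X = _]mxE.
have uN : mc_coords F x \in unitmx by rewrite unitmxE unitfE.
by rewrite -(mulmxK uN v) vN mul0mx.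
Qed.

(** Coordinates of the second kind, modified so that the straight line through [xi] is mapped onto
    the orbit curve of [X]: on this line [adapted_time] is the parameter and every
    [adapted_coord l] vanishes. *)
Section AdaptedChart.
Variables (X : M) (mX : m_space X) (l0 : 'I_d).
Local Notation xi := (coords_of_m X).
Hypothesis xi0 : xi 0 l0 != 0.

Definition adapted_time (x : E) : R := x 0 l0 * (xi 0 l0)^-1.
Definition adapted_coord (l : 'I_d) (x : E) : R := x 0 l + adapted_time x * (- xi 0 l).
Definition adapted_chart (x : E) : M :=
  expmx ((adapted_time x)%:C%C *: X) *m
  \big[mulmx/1%:M]_l expmx ((adapted_coord l x)%:C%C *: m_of_coords (e l)).

Lemma linear_adapted_time : linear_form adapted_time.
Proof. exact: linear_formM (linear_form_coord l0). Qed.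

Lemma linear_adapted_coord l : linear_form (adapted_coord l).
Proof.
exact: linear_formD (linear_form_coord l) (linear_formM _ linear_adapted_time).
Qed.

Let sX : skewhermitian X. Proof. by case: mX. Qed.
Let trX : \tr X = 0. Proof. by rewrite /mxtrace big1 //; case: mX. Qed.

Lemma trig_adapted_chart : trig_mx adapted_chart.
Proof.
apply: trig_mx_mul; first exact: trig_mx_expmx linear_adapted_time.
apply: big_mulmx_trig => l.
exact: trig_mx_expmx (m_of_coords_skew _) (linear_adapted_coord l).
Qed.

Lemma SU_adapted_chart x : SU (adapted_chart x).
Proof.
apply: SU_mul; first exact: SU_expmx.
apply: (big_ind (fun g : M => SU g)); [exact: SU1|exact: SU_mul|].
by move=> l _; apply: SU_expmx; [exact: m_of_coords_skew|exact: m_of_coords_trace].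
Qed.

Lemma adapted_chart_curve (t : R) : adapted_chart (t *: xi) = expmx (t%:C%C *: X).
Proof.
have tE : adapted_time (t *: xi) = t by rewrite /adapted_time mxE mulfK.
rewrite /adapted_chart tE (eq_bigr (fun=> 1%:M)) ?big_mulmx1 ?mulmx1 // => l _.
rewrite /adapted_coord tE mxE mulrN subrr expmx0 //; exact: m_of_coords_skew.
Qed.

(** Write phi for [adapted_time], and E_l for the image of the l-th basis vector in m. The
    derivative is phi_k X plus the sum over [l] of (delta_kl - phi_k xi_l) E_l, and X is the sum
    of the xi_l E_l, so that only E_k remains. *)
Lemma partial_adapted_chart k : partial_mx k adapted_chart 0 = m_of_coords (e k).
Proof.
have h0 := is_mxderive_partial k (trig_mx_smooth setT trig_adapted_chart) (I : setT 0).
apply: (is_mxderive_unique h0).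
have h1 := is_mxderive_expmx_linear (e k) sX linear_adapted_time.
have F1 l : expmx ((adapted_coord l 0)%:C%C *: m_of_coords (e l)) = 1%:M.
  by rewrite (linear_form0 (linear_adapted_coord l)) expmx0 //; exact: m_of_coords_skew.
have h2 := is_mxderive_big (index_enum 'I_d) F1
  (fun l => is_mxderive_expmx_linear (e k) (m_of_coords_skew (e l)) (linear_adapted_coord l)).
have := is_mxderiveM h1 h2; congr is_mxderive.
rewrite (linear_form0 linear_adapted_time) (expmx0 sX) mul1mx.
rewrite (eq_bigr (fun=> 1%:M)) ?big_mulmx1 ?mulmx1; last by move=> l _; exact: F1.
rewrite -{1}(coords_of_mK mX) (m_of_coords_sum xi) scaler_sumr -big_split.
rewrite [RHS]m_of_coords_sum; apply: eq_bigr => l _ /=.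
rewrite scalerA -scalerDl; congr (_ *: _); rewrite -rmorphM -rmorphD /=; congr (_%:C)%C.
by rewrite /adapted_coord; ring.
Qed.

Lemma adapted_chart0 : adapted_chart 0 = 1%:M.
Proof. by have := adapted_chart_curve 0; rewrite scale0r => ->; exact: expmx0. Qed.

Lemma mc_form_adapted k : mc_form adapted_chart k 0 = m_of_coords (e k).
Proof. by rewrite /mc_form adapted_chart0 partial_adapted_chart trmx1 map_mx1 mul1mx. Qed.

Lemma regular0 : regular_set adapted_chart 0.
Proof.
rewrite /regular_set /= (_ : mc_coords _ _ = 1%:M) ?det1 ?oner_eq0 //.
apply/row_matrixP => l; rewrite rowK row1 mc_form_adapted; exact: m_of_coordsK.
Qed.

(** The geodesic equation at time 0 in the adapted chart, where the Maurer-Cartan form takes the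
    basis vectors of m as values. *)
Lemma geodesic_bracket lam : metric_coefs lam -> geodesic lam (orbit_curve X) ->
  forall l, bform lam X (X *m m_of_coords (e l) - m_of_coords (e l) *m X) = 0.
Proof.
move=> lamP [_ G] l.
have lcU := regular_local_coordinates trig_adapted_chart SU_adapted_chart.
pose y (t : R) : E := t *: xi.
pose J : set R := [set t | regular_set adapted_chart (y t)].
have oJ : open J.
  have cy : continuous y by move=> t; apply: cvgZr_tmp; exact: cvg_id.
  by move/continuousP: cy; apply; exact: open_regular_set trig_adapted_chart.
have J0 : J 0 by rewrite /J /= /y scale0r; exact: regular0.
have ys k : smooth_path_on J (fun t => y t 0 k).
  apply: trig_smooth_path; apply: trig_lin; split=> [x h v|t].
    by rewrite !mxE mulrDl mulrA.
  rewrite (_ : (fun t => y t 0 k) = (fun t => t * xi 0 k)).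
    by apply: cvgM; [exact: cvg_id|exact: cvg_cst].
  by apply/funext => z; rewrite mxE.
have yc t : J t -> regular_set adapted_chart (y t) /\ orbit_curve X t = coset (adapted_chart (y t)).
  by move=> Jt; split; [exact: Jt|rewrite adapted_chart_curve].
have /(geodesic_equationP mX lamP lcU oJ ys yc J0)/(_ l) := G _ _ _ _ lcU oJ ys yc 0 J0.
by rewrite /y scale0r adapted_chart0 mc_form_adapted trmx1 map_mx1 mul1mx mulmx1.
Qed.

End AdaptedChart.
End Chart.

(** * The bracket condition *)

Local Opaque mc_form.

Section Bracket.
Variables (R : realType) (n : nat).
Local Notation C := R[i].
Local Notation M := 'M[C]_n.
Local Notation d := (flag_dim n).
Local Notation E := 'rV[R]_d.
Local Notation e l := (delta_mx 0 l : E).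

(** The commutator [Lambda P, P], written entrywise. *)
Definition metric_bracket (lam : 'I_n -> 'I_n -> R) (P : M) : M :=
  \matrix_(i, j) \sum_m (offdiag_coef lam i m - offdiag_coef lam m j)%:C%C * (P i m * P m j).

Lemma bform_trace lam (P Q : M) :
  bform lam P Q = - (complex.Re (\tr ((\matrix_(a, b) ((offdiag_coef lam a b)%:C%C * P a b)) *m Q)) *+ n *+ 2).
Proof.
rewrite /bform; congr (- (complex.Re _ *+ _ *+ _)); apply: eq_bigr => a _.
by rewrite mxE; apply: eq_bigr => b _; rewrite mxE mulrA.
Qed.

Lemma bform_metric_bracket lam (P Z : M) :
  bform lam P (P *m Z - Z *m P) = - (complex.Re (\tr (metric_bracket lam P *m Z)) *+ n *+ 2).
Proof.
rewrite bform_trace; congr (- (complex.Re _ *+ _ *+ _)).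
set L := \matrix_(a, b) _.
have -> : metric_bracket lam P = L *m P - P *m L.
  apply/matrixP => i j; rewrite mxE [RHS]mxE [X in _ + X]mxE mxE [X in _ - X]mxE -sumrB.
  apply: eq_bigr => m _; rewrite !mxE rmorphB /=; ring.
rewrite mulmxBr mulmxBl !linearB /= !mulmxA; congr (_ - _).
by rewrite mxtrace_mulC mulmxA.
Qed.

(** If both factors were nonzero, then so would be X_mi and X_mj, in the same row. *)
Lemma essentially_diagonal_mul (X : M) i j m : skewhermitian X -> essentially_diagonal X ->
  i != j -> X i m * X m j = 0.
Proof.
move=> sX [er _] ij; apply/eqP; rewrite mulf_eq0; apply/negPn; rewrite negb_or.
apply/negP => /andP[h1 h2]; move/eqP: ij; apply; apply: (er m) => //.
have /matrixP/(_ m i) := sX; rewrite adjmxE mxE => h.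
by apply: contraNneq h1 => h3; move: h; rewrite h3 oppr0 => /eqP; rewrite conjC_eq0.
Qed.

Variable lam : 'I_n -> 'I_n -> R.
Hypothesis lamP : metric_coefs lam.

Lemma metric_bracket_essentially_diagonal (X k : M) :
  skewhermitian X -> essentially_diagonal X -> (forall a b, a != b -> k a b = 0) ->
  metric_bracket lam (k^t* *m X *m k) = 0.
Proof.
move=> sX edX kd.
have YE a b : (k^t* *m X *m k) a b = Num.conj (k a a) * X a b * k b b.
  rewrite mxE (bigD1 b) //= big1 ?addr0 => [|c cb]; last by rewrite kd ?mulr0.
  rewrite mxE (bigD1 a) //= big1 ?addr0 ?adjmxE // => c ca.
  by rewrite adjmxE kd // conjC0 mul0r.
apply/matrixP => i j; rewrite mxE [RHS]mxE big1 // => m _.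
have [<-|ij] := eqVneq i j; first by rewrite (offdiag_coef_sym lamP m i) subrr mul0r.
have alg (z a b c f x y : C) : z * (a * x * b * (c * y * f)) = z * (a * b * c * f) * (x * y).
  by ring.
by rewrite !YE alg (essentially_diagonal_mul m sX edX ij) mulr0.
Qed.

Lemma metric_bracket_m_space (X : M) : m_space X -> m_space (metric_bracket lam X).
Proof.
move=> [sX X0]; split; last first.
  by move=> i; rewrite mxE big1 // => m _; rewrite (offdiag_coef_sym lamP m i) subrr mul0r.
apply/matrixP => i j; rewrite adjmxE !mxE rmorph_sum -sumrN; apply: eq_bigr => m _.
have hX a b : Num.conj (X b a) = - X a b.
  by have /matrixP/(_ a b) := sX; rewrite adjmxE mxE.
rewrite !rmorphM /= !hX mulrNN (offdiag_coef_sym lamP j m) (offdiag_coef_sym lamP m i).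
rewrite [X m j * _]mulrC -mulNr; congr (_ * _).
by apply: complex_eq; rewrite ?Re_conj ?Im_conj ?ReN ?ImN /= ?opprB ?oppr0.
Qed.

(** The bracket lies in m and is orthogonal to a basis of m, for the form with all coefficients
    equal to 1. *)
Lemma metric_bracket_eq0 (X : M) : m_space X ->
  (forall l, bform lam X (X *m m_of_coords (e l) - m_of_coords (e l) *m X) = 0) ->
  metric_bracket lam X = 0.
Proof.
move=> mX H; set Z := metric_bracket lam X.
have mZ : m_space Z by exact: metric_bracket_m_space.
pose lam1 (_ _ : 'I_n) : R := 1.
have lam1P : metric_coefs lam1 by split.
have EZ : \matrix_(a, b) ((offdiag_coef lam1 a b)%:C%C * Z a b) = Z.
  apply/matrixP => a b; rewrite mxE /offdiag_coef; case: eqVneq => [->|_].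
    by rewrite mul0r; case: mZ.
  by rewrite mul1r.
have BE Q : bform lam1 Z Q = - (complex.Re (\tr (Z *m Q)) *+ n *+ 2).
  by rewrite bform_trace EZ.
have Z0 : bform lam1 Z Z = 0.
  rewrite -{2}(coords_of_mK mZ) m_of_coords_sum (bform_sumr lam1P) big1 // => l _.
  by rewrite (bformZr lam1P) BE -bform_metric_bracket H mulr0.
have := bform_definite lam1P mZ.1 Z0 => /matrixP pZ.
apply/matrixP => a b; have := pZ a b; rewrite !mxE.
by case: eqVneq => // -> _; case: mZ => _ /(_ b); rewrite mxE.
Qed.

End Bracket.

(** Giving the pair (i, k) the coefficient 2 and all other pairs the coefficient 1 leaves the single
    term X_ik X_kj in the entry (i, j) of the bracket. *)
Lemma essentially_diagonal_of_brackets (R : realType) n (X : 'M[R[i]]_n) : m_space X ->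
  (forall lam, metric_coefs lam -> metric_bracket lam X = 0) -> essentially_diagonal X.
Proof.
move=> [sX X0] H.
have key i j k : i != j -> i != k -> k != j -> X i k * X k j = 0.
  move=> ij ik kj.
  pose lam (p q : 'I_n) : R :=
    1 + (((p == i) && (q == k)) || ((p == k) && (q == i)))%:R.
  have lamP : metric_coefs lam.
    split=> [p q|p q _]; last by rewrite /lam ltr_wpDr.
    by rewrite /lam orbC andbC [(q == k) && _]andbC.
  have /matrixP/(_ i j) := H lam lamP; rewrite !mxE (bigD1 k) //= big1 ?addr0 => [|m mk].
    rewrite /offdiag_coef (negbTE ik) (negbTE kj) /lam !eqxx /= (eq_sym j k) (negbTE kj).
    rewrite (eq_sym j i) (negbTE ij) !andbF /= addr0 addrK => <-.
    by rewrite mul1r.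
  have [->|mi] := eqVneq m i; first by rewrite X0 mul0r mulr0.
  have [->|mj] := eqVneq m j; first by rewrite X0 !mulr0.
  rewrite /offdiag_coef (eq_sym i m) (negbTE mi) (negbTE mj) /lam (negbTE mk) (negbTE mi).
  rewrite (eq_sym j k) (negbTE kj) (eq_sym j i) (negbTE ij) !andbF /= subrr.
  by rewrite mul0r.
have nz a b : X a b != 0 -> X b a != 0.
  apply: contraNneq => h; have /matrixP/(_ a b) := sX; rewrite adjmxE mxE h conjC0.
  by move=> /esym/eqP; rewrite oppr_eq0.
have offd a b : X a b != 0 -> a != b by apply: contraNneq => ->; rewrite X0.
split=> i j k h1 h2; apply/eqP/negPn/negP => jk.
  have /eqP := key j k i jk (offd _ _ (nz _ _ h1)) (offd _ _ h2).
  by rewrite mulf_eq0 (negbTE (nz _ _ h1)) (negbTE h2).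
have /eqP := key i j k jk (offd _ _ h1) (offd _ _ (nz _ _ h2)).
by rewrite mulf_eq0 (negbTE h1) (negbTE (nz _ _ h2)).
Qed.

(** [X] commutes with its exponential, so conjugating it by [g] only involves the factor [k]. *)
Lemma conj_expmx (R : realType) n (X : 'M[R[i]]_n) (t : R) (g k : 'M[R[i]]_n) :
  m_space X -> k = (expmx (t%:C%C *: X))^t* *m g ->
  g^t* *m X *m g = k^t* *m X *m k.
Proof.
move=> mX ->; have uW := expmx_unitary mX t; have [sX _] := mX.
have cX := expmx_comm sX t.
rewrite trmxC_mul trmxCK; set W := expmx _ in uW cX *.
by rewrite -(mulmxA _ W X) -cX !mulmxA -(mulmxA _ W (W^t*)) uW mulmx1.
Qed.

Lemma equigeodesic_essentially_diagonal (R : realType) n (X : 'M[R[i]]_n) :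
  m_space X -> equigeodesic_vector X <-> essentially_diagonal X.
Proof.
move=> mX; split=> [eqX|edX lam lamP].
  have [l0|x0] := pselect (exists l0, coords_of_m X 0 l0 != 0).
    have [l0' hl0] := l0.
    apply: essentially_diagonal_of_brackets => // lam lamP.
    apply: metric_bracket_eq0 => //.
    exact: geodesic_bracket hl0 lam lamP (eqX lam lamP).
  have -> : X = 0.
    rewrite -(coords_of_mK mX) (_ : coords_of_m X = 0).
      by rewrite m_of_coords_sum big1 // => l _; rewrite mxE scale0r.
    apply/rowP => l; rewrite mxE; apply/eqP/negPn/negP => h; apply: x0; by exists l.
  by split=> i j k; rewrite mxE eqxx.
split; first exact: smooth_orbit_curve.
move=> U s J y lc oJ ys yc t Jt.
apply/(geodesic_equationP mX lamP lc oJ ys yc Jt) => l.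
pose k := (expmx (t%:C%C *: X))^t* *m s (y t).
have YE : (s (y t))^t* *m X *m s (y t) = k^t* *m X *m k by exact: conj_expmx mX (erefl k).
have kd a b : a != b -> k a b = 0 by move=> ab; exact: (kappa_diag mX yc Jt ab).
have [sX _] := mX.
rewrite bform_metric_bracket YE (metric_bracket_essentially_diagonal lamP sX edX kd).
by rewrite mul0mx mxtrace0 /= !mul0rn oppr0.
Qed.

(** * Closed orbits and the main theorem *)

Section Closed.
Variable R : realType.
Local Notation C := R[i].

Lemma cis_2piz (z : int) : cis ((pi *+ 2) * z%:~R : R) = 1.
Proof.
have H k : cis ((pi *+ 2) * k%:R : R) = 1.
  elim: k => [|k IH]; first by rewrite mulr0 cis0.
  by rewrite -natr1 mulrDr mulr1 cisD IH mul1r /cis cos2pi sin2pi.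
case: (intP z) => [|k|k]; first by rewrite mulr0z mulr0 cis0.
  exact: H.
by rewrite mulrNz mulrN -conj_cis -pmulrn H conjC1.
Qed.

(** Real valued, unlike the square of the norm on [R[i]]. *)
Definition sqr_modulus (z : C) : R := complex.Re z ^+ 2 + complex.Im z ^+ 2.

Lemma sqr_modulus_eq0 z : (sqr_modulus z == 0) = (z == 0).
Proof.
rewrite /sqr_modulus paddr_eq0 ?sqr_ge0 // !sqrf_eq0; apply/andP/eqP => [[/eqP h1 /eqP h2]|-> //].
exact: complex_eq.
Qed.

Lemma ratr_complex (q : rat) : ratr q = (ratr q : R)%:C%C :> C.
Proof. by rewrite -(fmorph_rat (real_complex R)). Qed.

Lemma Q_dependent_modulus (z w : C) : Q_dependent w z -> z != 0 ->
  exists q : rat, sqr_modulus w = (ratr q) ^+ 2 * sqr_modulus z.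
Proof.
move=> [p [q [pq E]]] z0.
have p0 : p != 0.
  apply/eqP => p0; apply: pq; congr (_, _) => //.
  move: E; rewrite p0 rmorph0 mul0r add0r => /eqP; rewrite mulf_eq0 (negbTE z0) orbF.
  by rewrite fmorph_eq0 => /eqP.
exists (- q / p).
have wE : w = (ratr (- q / p) : R)%:C%C * z.
  rewrite -ratr_complex rmorphM fmorphV rmorphN /=.
  have rp0 : ratr p != 0 :> C by rewrite fmorph_eq0.
  apply: (mulfI rp0); move: E => /eqP; rewrite addr_eq0 => /eqP ->.
  by field.
by rewrite wE /sqr_modulus Re_rM Im_rM; ring.
Qed.

Lemma commensurate_moduli n (A : 'M[C]_n) : commensurate_entries A ->
  exists2 rho : R, 0 < rho & forall i j, exists q : rat,
    sqr_modulus (A i j) = (ratr q * rho) ^+ 2.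
Proof.
move=> cA; have [[i [j Aij]]|A0] := pselect (exists i j, A i j != 0).
  have m0 : 0 < sqr_modulus (A i j).
    by rewrite lt_neqAle eq_sym sqr_modulus_eq0 Aij addr_ge0 // sqr_ge0.
  exists (Num.sqrt (sqr_modulus (A i j))); first by rewrite sqrtr_gt0.
  move=> k l; have [q ->] := Q_dependent_modulus (cA k l i j) Aij.
  by exists q; rewrite [RHS]exprMn; congr (_ * _); rewrite sqr_sqrtr // ltW.
exists 1 => // i j; exists 0; rewrite rmorph0 mul0r expr0n /=; apply/eqP.
by rewrite sqr_modulus_eq0; apply/negPn/negP => h; apply: A0; exists i, j.
Qed.

Lemma essentially_diagonal_sqr n (A : 'M[C]_n) (a b : 'I_n) : m_space A -> essentially_diagonal A ->
  (A *m A) a b = if a == b then - (\sum_m sqr_modulus (A a m))%:C%C else 0.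
Proof.
move=> [sA A0] eA; rewrite mxE; case: eqVneq => [<-|ab].
  rewrite rmorph_sum -sumrN; apply: eq_bigr => m _ /=.
  have /matrixP/(_ m a) := sA; rewrite adjmxE mxE => h.
  have -> : A m a = - Num.conj (A a m) by rewrite h opprK.
  by apply: complex_eq; rewrite mulrN ?ReN ?ImN ?ReM ?ImM ?Re_conj ?Im_conj /= /sqr_modulus; ring.
by rewrite big1 // => m _; exact: essentially_diagonal_mul.
Qed.

(** The row has at most one nonzero entry. *)
Lemma essentially_diagonal_row n (A : 'M[C]_n) (a : 'I_n) : m_space A -> essentially_diagonal A ->
  exists m, \sum_k sqr_modulus (A a k) = sqr_modulus (A a m).
Proof.
move=> [sA A0] [er _].
have [[m Aam]|Aa0] := pselect (exists m, A a m != 0).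
  exists m; rewrite (bigD1 m) //= big1 ?addr0 // => k km; apply/eqP.
  rewrite sqr_modulus_eq0; apply: contraNT km => Aak; apply/eqP; exact: er Aak Aam.
exists a; rewrite (A0 a) (eqP (_ : sqr_modulus 0 == 0)) ?sqr_modulus_eq0 //.
apply: big1 => k _; apply/eqP; rewrite sqr_modulus_eq0; apply/negPn/negP => h.
by apply: Aa0; exists k.
Qed.

Lemma unitary_row_neq0 n (P : 'M[C]_n) (j : 'I_n) : P \is unitarymx -> exists a, P j a != 0.
Proof.
move=> /unitarymxP uP.
have [//|P0] := pselect (exists a, P j a != 0).
have /matrixP/(_ j j) := uP; rewrite !mxE eqxx big1 => [/esym/eqP|k _].
  by rewrite oner_eq0.
rewrite (_ : P j k = 0) ?mul0r //; apply/eqP/negPn/negP => h; apply: P0; by exists k.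
Qed.

(** 2 pi N / rho is a common period, for [N] the product of the denominators. *)
Lemma common_period n (q : 'I_n -> rat) (rho : R) : 0 < rho ->
  exists2 T : R, 0 < T & forall j, exists z : int, T * (ratr (q j) * rho) = pi *+ 2 * z%:~R.
Proof.
move=> rho0; pose N : int := \prod_j denq (q j).
have N0 : 0 < N by apply: prodr_gt0 => j _; exact: denq_gt0.
have pi2 : 0 < pi *+ 2 :> R by rewrite pmulrn_lgt0 // pi_gt0.
exists (pi *+ 2 * N%:~R / rho).
  by rewrite divr_gt0 // mulr_gt0 // ltr0z.
move=> j; exists (numq (q j) * \prod_(i | i != j) denq (q i)).
have -> : ratr (q j) = (numq (q j))%:~R / (denq (q j))%:~R :> R by [].
have d0 : (denq (q j))%:~R != 0 :> R by rewrite intr_eq0 denq_eq0.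
have r0 : rho != 0 by rewrite gt_eqF.
rewrite /N (bigD1 j) //= !intrM; set Q := (\prod_(i | _) _)%:~R.
by field; rewrite r0 d0.
Qed.

(** Row [j] of the unitary matrix [P] has a nonzero entry P_ja, and comparing the entries (j, a) in
    P A^2 = D^2 P, with D the diagonal matrix of the i th_j, gives th_j^2 = |A_am|^2
    for some [m]. *)
Lemma closed_orbit n (A : 'M[C]_n) : m_space A -> essentially_diagonal A ->
  commensurate_entries A -> closed_curve (orbit_curve A).
Proof.
move=> mA eA /commensurate_moduli [rho rho0 hq]; have [sA _] := mA.
have [P [th [uP EA Eexp]]] := expmx_skewP sA.
have thq j : exists q : rat, th j = ratr q * rho.
  have [a Pja] := unitary_row_neq0 j uP.
  have [m Em] := essentially_diagonal_row a mA eA.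
  have [q Eq] := hq a m.
  have E1 : (P *m (A *m A)) j a = P j a * - (sqr_modulus (A a m))%:C%C.
    rewrite mxE (bigD1 a) //= big1 ?addr0 => [|k ka].
      by rewrite essentially_diagonal_sqr // eqxx Em.
    by rewrite essentially_diagonal_sqr // (negbTE ka) mulr0.
  have E2 : (P *m (A *m A)) j a = - (th j ^+ 2)%:C%C * P j a.
    have -> : A *m A = conj_diag P (fun j => (0 +i* th j)%C * (0 +i* th j)%C).
      by rewrite {1 2}EA; exact: conj_diagM.
    rewrite mul_conj_diag // mul_diag_mx mxE mxE; congr (_ * _).
    by apply: complex_eq; rewrite ?ReM ?ImM ?ReN ?ImN /=; ring.
  have : th j ^+ 2 = (ratr q * rho) ^+ 2.
    rewrite -Eq; have := E2; rewrite E1 mulrC => /(mulIf Pja) /oppr_inj /(congr1 (@complex.Re R)) /= -> //.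
  move=> /eqP; rewrite eqf_sqr => /orP[/eqP ->|/eqP ->]; first by exists q.
  by exists (- q); rewrite rmorphN mulNr.
have [q qE] := choice thq.
have [T T0 HT] := common_period q rho0; exists T; first exact: T0.
move=> t.
have cisT : (fun j => cis ((t + T) * th j)) = (fun j => cis (t * th j)).
  apply/funext => j; have [z hz] := HT j.
  have Tth : T * th j = pi *+ 2 * z%:~R by rewrite -hz -qE.
  by rewrite mulrDl cisD Tth cis_2piz mulr1.
by rewrite /orbit_curve (Eexp (t + T)) cisT -(Eexp t).
Qed.

End Closed.

Theorem corollary1p3 (R : realType) (n : nat) (A : 'M[complex R]_n)
    (hA : m_space A) :
  (equigeodesic_vector A <-> essentially_diagonal A) /\
  (equigeodesic_vector A -> commensurate_entries A ->
   closed_curve (orbit_curve A)).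
Proof.
split; first exact: equigeodesic_essentially_diagonal.
by move=> /(equigeodesic_essentially_diagonal hA); exact: closed_orbit.
Qed.
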